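(* For all $a,b,c\in\mathbb{Z}_{\ge1}$ and $m,n\in\mathbb{Z}_{\ge0}$, the following identity holds in $\mathfrak{H}^1$: \[ \sum_{\substack{i+p+2q=m\\ j+u_1+\cdots+u_p+v_1+\cdots+v_q=n}} (-2)^p\,d\bigl(z_{c}^i\mathbin{\widetilde{\sqcup}}(z_{a}z_{b})^j\bigr)* \bigl(z_{(a+b)u_1+c}\cdots z_{(a+b)u_p+c}\mathbin{\widetilde{\sqcup}} z_{(a+b)v_1+2c}\cdots z_{(a+b)v_q+2c}\bigr) =(-1)^m\sum_{j+k=n}\bigl(z_c^m\mathbin{\widetilde{\sqcup}}(z_az_b)^j\bigr)*d(z_{a+b}^k). \] Here the left-hand sum runs over all nonnegative integers $i,j,p,q$ and all nonnegative integers $u_1,\ldots,u_p,v_1,\ldots,v_q$ satisfying the two displayed conditions, and the right-hand sum runs over all nonnegative integers $j,k$ with $j+k=n$.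
   Context: Let $\mathfrak{H}=\mathbb{Q}\langle x,y\rangle$ be the non-commutative polynomial algebra, $\mathfrak{H}^1=\mathbb{Q}+\mathfrak{H}y$, and $z_a=x^{a-1}y$ for $a\in\mathbb{Z}_{\ge1}$. For a finite (possibly empty) sequence $\boldsymbol a=(a_1,\ldots,a_n)$ of positive integers put $z_{\boldsymbol a}=z_{a_1}\cdots z_{a_n}$ (with $z_\emptyset=1$); these form a $\mathbb{Q}$-basis of $\mathfrak{H}^1$. Juxtaposition and powers denote the concatenation product; empty products are $1$. Put $[n]=\{1,\ldots,n\}$, $[0]=\emptyset$. The $\mathbb{Q}$-linear map $d\colon\mathfrak{H}^1\to\mathfrak{H}^1$ is defined by $d(z_{\boldsymbol a})=\sum_{(l,\sigma)}z_{\boldsymbol c}$ for $\boldsymbol a=(a_1,\ldots,a_n)$, the sum being over all $l\in\mathbb{Z}_{\ge0}$ and all nondecreasing surjections $\sigma\colon[n]\to[l]$, where $\boldsymbol c=(c_1,\ldots,c_l)$, $c_i=\sum_{s\in\sigma^{-1}(i)}a_s$. The $\mathbb{Q}$-bilinear maps $*,\widetilde{\sqcup}\colon\mathfrak{H}^1\times\mathfrak{H}^1\to\mathfrak{H}^1$ are defined, for $\boldsymbol a=(a_1,\ldots,a_m)$ and $\boldsymbol b=(b_1,\ldots,b_n)$, by $z_{\boldsymbol a}*z_{\boldsymbol b}=\sum_{(l,\sigma,\tau)\in S^*_{m,n}}z_{\boldsymbol c}$ and $z_{\boldsymbol a}\mathbin{\widetilde{\sqcup}}z_{\boldsymbol b}=\sum_{(l,\sigma,\tau)\in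 S^{\widetilde{\sqcup}}_{m,n}}z_{\boldsymbol c}$, where $c_i=\sum_{s\in\sigma^{-1}(i)}a_s+\sum_{t\in\tau^{-1}(i)}b_t$ for $i\in[l]$; here $S^*_{m,n}$ is the set of triples $(l,\sigma,\tau)$ with $l\in\mathbb{Z}_{\ge0}$ and strictly increasing maps $\sigma\colon[m]\to[l]$, $\tau\colon[n]\to[l]$ with $\operatorname{Im}\sigma\cup\operatorname{Im}\tau=[l]$, and $S^{\widetilde{\sqcup}}_{m,n}$ is the subset of those with $\operatorname{Im}\sigma\cap\operatorname{Im}\tau=\emptyset$. *)

(* Defs.v *)
From HB Require Import structures.
From mathcomp Require Import all_boot all_algebra.
From mathcomp Require Import finmap.
From mathcomp.multinomials Require Import monalg.

Set Implicit Arguments.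
Unset Strict Implicit.
Unset Printing Implicit Defensive.

Import GRing.Theory.
Local Open Scope ring_scope.

(* The free algebra Q<x,y>: words are {fmonom bool}, with x = false and       *)
(* y = true.                                                                  *)
Notation H := {malg rat[{fmonom bool}]}.

Definition X : H := << fmu false >>.
Definition Y : H := << fmu true >>.

(* Every word in the support is empty or ends with y; in_H1E below states     *)
(* that this is Q + Hy.                                                       *)
Definition in_H1 : {pred H} :=
  [pred h : H | all (fun w : {fmonom bool} => last true w) (msupp h)].

Lemma in_H1P (h : H) :
  reflect (forall w : {fmonom bool}, ~~ last true w -> h@_w = 0) (h \in in_H1).
Proof.
apply: (iffP allP) => [hh w wl|hh w].
  by apply: mcoeff_outdom; apply: contra wl => /hh.
by rewrite -mcoeff_neq0; apply: contraNT => /hh ->.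
Qed.

Lemma in_H1_subalg : subalg_closed in_H1.
Proof.
split.
- apply/in_H1P => w wl; rewrite mcoeff1; case: eqP => // e.
  by rewrite e fm1 in wl.
- move=> a u v /in_H1P hu /in_H1P hv; apply/in_H1P => w wl.
  by rewrite mcoeffD mcoeffZ hu // hv // mulr0 addr0.
- move=> u v /allP hu /allP hv; apply/allP => w /msuppM_le [w1 [w2 [h1 h2 ->]]].
  rewrite fmM last_cat; move: (hu _ h1) (hv _ h2).
  by case: (fmonom_val w2) => [|x s] //=.
Qed.

HB.instance Definition _ :=
  GRing.isSubalgClosed.Build rat H in_H1 in_H1_subalg.

Lemma in_H1_mulY (h : H) : h * Y \in in_H1.
Proof.
apply/allP => w /msuppM_le [w1 [w2 [_ h2 ->]]].
move: h2; rewrite msuppU1 inE => /eqP ->.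
by rewrite fmM last_cat fmU.
Qed.

Lemma in_H1E (h : H) :
  h \in in_H1 <-> exists (q : rat) (g : H), h = q%:A + g * Y.
Proof.
split=> [/allP hh|[q [g ->]]]; last first.
  by rewrite rpredD ?in_H1_mulY ?rpredZ ?rpred1.
rewrite (monalgE h) big_seq.
apply: (big_ind (fun h => exists (q : rat) (g : H), h = q%:A + g * Y))
  => [|_ _ [q [g ->]] [q' [g' ->]]|w /hh wl].
- by exists 0, 0; rewrite scale0r mul0r addr0.
- by exists (q + q'), (g + g'); rewrite scalerDl mulrDl addrACA.
move: (h@_w) wl => r; case: w => s /=.
case: (lastP s) => [_|s' b].
  by exists r, 0; rewrite mul0r addr0 -fmoneE -mul_malgC mulr1.
rewrite last_rcons => ->; exists 0, << r *g FMonom s' >>.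
rewrite scale0r add0r malgM_def fgmulUU mulr1; congr << _ *g _ >>.
by apply/eqP; rewrite fmP fmM fmU cats1.
Qed.

(* The subalgebra Q + Hy, with concatenation as its product.                  *)
Record H1 := MkH1 { H1val : H; H1valP : H1val \in in_H1 }.
HB.instance Definition _ := [isSub for H1val].
HB.instance Definition _ := [Choice of H1 by <:].
HB.instance Definition _ := [SubChoice_isSubLalgebra of H1 by <:].

Lemma H1val1 : H1val 1 = 1.
Proof. exact: (rmorph1 (val : H1 -> H)). Qed.

Lemma H1valM g h : H1val (g * h) = H1val g * H1val h.
Proof. exact: (rmorphM (val : H1 -> H)). Qed.

Lemma H1val_linear : linear H1val.
Proof. exact: (linearP (val : H1 -> H)). Qed.
HB.instance Definition _ := GRing.isLinear.Build rat H1 H *:%R H1val H1val_linear.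

(* x^(a-1) y; only meaningful for a >= 1 (z 0 is the junk value y).           *)
Definition z (a : nat) : H1 := MkH1 (in_H1_mulY (X ^+ a.-1)).

Definition zs (a : seq nat) : H1 := \prod_(k <- a) z k.

(* Exponent sequence of a word: x^(a_1-1) y ... x^(a_n-1) y |-> a_1, ..., a_n *)
(* (k counts the letters x already read in the current block).                *)
Fixpoint blocks (k : nat) (w : seq bool) : seq nat :=
  match w with
  | [::] => [::]
  | false :: w' => blocks k.+1 w'
  | true :: w' => k.+1 :: blocks 0 w'
  end.

(* Q-linear extension to H1 of a map given on the basis zs; see lin_ext_zs.   *)
Definition lin_ext (f : seq nat -> H1) (h : H1) : H1 :=
  \sum_(w <- msupp (H1val h)) (H1val h)@_w *: f (blocks 0 w).

Definition bilin_ext (f : seq nat -> seq nat -> H1) (g h : H1) : H1 :=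
  lin_ext (fun a => lin_ext (f a) h) g.

Definition nondecr (m l : nat) (s : {ffun 'I_m -> 'I_l}) : bool :=
  [forall i : 'I_m, forall j : 'I_m, (i <= j)%N ==> (s i <= s j)%N].

Definition incr (m l : nat) (s : {ffun 'I_m -> 'I_l}) : bool :=
  [forall i : 'I_m, forall j : 'I_m, (i < j)%N ==> (s i < s j)%N].

(* In the three sums below, the bounds l <= n and l <= m + n are implied by   *)
(* the surjectivity conditions.                                               *)
Definition d_basis (a : seq nat) : H1 :=
  \sum_(l < (size a).+1)
    \sum_(s : {ffun 'I_(size a) -> 'I_l} | nondecr s && (s @: setT == setT))
      zs [seq (\sum_(k < size a | s k == i) nth 0 a k)%N | i <- enum 'I_l].

Definition merge_parts (a b : seq nat) (l : nat)
    (s : {ffun 'I_(size a) -> 'I_l}) (t : {ffun 'I_(size b) -> 'I_l}) :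
    seq nat :=
  [seq (\sum_(k < size a | s k == i) nth 0 a k
        + \sum_(k < size b | t k == i) nth 0 b k)%N | i <- enum 'I_l].

Definition star_basis (a b : seq nat) : H1 :=
  \sum_(l < (size a + size b).+1)
    \sum_(s : {ffun 'I_(size a) -> 'I_l})
      \sum_(t : {ffun 'I_(size b) -> 'I_l} |
              [&& incr s, incr t & s @: setT :|: t @: setT == setT])
        zs (merge_parts s t).

Definition sh_basis (a b : seq nat) : H1 :=
  \sum_(l < (size a + size b).+1)
    \sum_(s : {ffun 'I_(size a) -> 'I_l})
      \sum_(t : {ffun 'I_(size b) -> 'I_l} |
              [&& incr s, incr t, s @: setT :|: t @: setT == setT
                & s @: setT :&: t @: setT == set0])
        zs (merge_parts s t).

Definition d : H1 -> H1 := lin_ext d_basis.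
Definition star : H1 -> H1 -> H1 := bilin_ext star_basis.
Definition sh : H1 -> H1 -> H1 := bilin_ext sh_basis.

Lemma surj_bound (n l : nat) (s : {ffun 'I_n -> 'I_l}) :
  s @: setT = setT -> (l <= n)%N.
Proof.
move=> e; rewrite -[l]card_ord -cardsT -e.
by apply: leq_trans (leq_imset_card _ _) _; rewrite cardsT card_ord.
Qed.

Lemma cover_bound (m n l : nat)
    (s : {ffun 'I_m -> 'I_l}) (t : {ffun 'I_n -> 'I_l}) :
  s @: setT :|: t @: setT = setT -> (l <= m + n)%N.
Proof.
move=> e; rewrite -[l]card_ord -cardsT -e.
apply: leq_trans (leq_card_setU _ _) _.
by apply: leq_add; apply: leq_trans (leq_imset_card _ _) _;
  rewrite cardsT card_ord.
Qed.

Definition word (a : seq nat) : {fmonom bool} :=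
  FMonom (flatten [seq rcons (nseq k.-1 false) true | k <- a]).

Lemma H1val_z (a : nat) :
  H1val (z a) = << FMonom (rcons (nseq a.-1 false) true) >>.
Proof.
rewrite /z /=; have -> : X ^+ a.-1 = << FMonom (nseq a.-1 false) >>.
  elim: a.-1 => [|n IH]; first by rewrite expr0 -fmoneE.
  rewrite exprS IH malgM_def fgmulUU mulr1; congr << _ *g _ >>.
  by apply/eqP; rewrite fmP fmM fmU.
rewrite malgM_def fgmulUU mulr1; congr << _ *g _ >>.
by apply/eqP; rewrite fmP fmM fmU cats1.
Qed.

Lemma H1val_zs (a : seq nat) : H1val (zs a) = << word a >>.
Proof.
elim: a => [|k a IH]; rewrite /zs.
  by rewrite big_nil H1val1 /word /= -fmoneE.
rewrite big_cons H1valM H1val_z IH malgM_def fgmulUU mulr1; congr << _ *g _ >>.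
by apply/eqP; rewrite fmP fmM.
Qed.

Lemma blocks_word (a : seq nat) :
  all (leq 1) a -> blocks 0 (word a) = a.
Proof.
rewrite /word /=.
elim: a => //= k a IH /andP[k0 /IH {}IH].
have E n m s : blocks n (rcons (nseq m false) true ++ s)
  = (n + m).+1 :: blocks 0 s.
  elim: m n => [|m IHm] n /=; first by rewrite addn0.
  by rewrite IHm addSnnS.
by rewrite E IH prednK.
Qed.

Lemma lin_ext_linear f : linear (lin_ext f).
Proof.
move=> r u v; rewrite /lin_ext.
set D := (msupp (H1val u) `|` msupp (H1val v))%fset.
have ext (h : H1) : (msupp (H1val h) `<=` D)%fset ->
  \sum_(w <- msupp (H1val h)) (H1val h)@_w *: f (blocks 0 w)
  = \sum_(w <- D) (H1val h)@_w *: f (blocks 0 w).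
  move=> sD; apply: big_fset_incl => // w _ /mcoeff_outdom ->.
  by rewrite scale0r.
have valE := H1val_linear r u v.
have sub : (msupp (H1val (r *: u + v)%R) `<=` D)%fset.
  rewrite valE; apply: fsubset_trans (msuppD_le _ _) _.
  exact: fsetSU (msuppZ_le _ _).
rewrite (ext _ sub) (ext u) ?fsubsetUl // (ext v) ?fsubsetUr //.
rewrite scaler_sumr -big_split; apply: eq_bigr => w _.
by rewrite valE mcoeffD mcoeffZ scalerDl scalerA.
Qed.

HB.instance Definition _ f :=
  GRing.isLinear.Build rat H1 H1 *:%R (lin_ext f) (lin_ext_linear f).
HB.instance Definition _ := GRing.Linear.on d.

Lemma lin_ext_zs f (a : seq nat) : all (leq 1) a -> lin_ext f (zs a) = f a.
Proof.
move=> a0; rewrite /lin_ext H1val_zs msuppU1 big_seq_fset1 mcoeffUU scale1r.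
by rewrite blocks_word.
Qed.

Lemma lin_ext_pointwise f1 f2 r :
  (fun a => lin_ext (fun b => r *: f1 b + f2 b) a)
  =1 (fun a => r *: lin_ext f1 a + lin_ext f2 a).
Proof.
move=> h; rewrite /lin_ext scaler_sumr -big_split; apply: eq_bigr => w _ /=.
by rewrite scalerDr !scalerA mulrC.
Qed.

Lemma bilin_ext_linear_l f h : linear ((bilin_ext f)^~ h).
Proof. exact: lin_ext_linear. Qed.

Lemma bilin_ext_linear_r f g : linear (bilin_ext f g).
Proof.
move=> r u v; rewrite /bilin_ext -lin_ext_pointwise.
by apply: eq_bigr => w _; rewrite lin_ext_linear.
Qed.

Lemma d_zs (a : seq nat) : all (leq 1) a -> d (zs a) = d_basis a.
Proof. exact: lin_ext_zs. Qed.

Lemma star_zs (a b : seq nat) :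
  all (leq 1) a -> all (leq 1) b -> star (zs a) (zs b) = star_basis a b.
Proof. by move=> a0 b0; rewrite /star /bilin_ext !lin_ext_zs. Qed.

Lemma sh_zs (a b : seq nat) :
  all (leq 1) a -> all (leq 1) b -> sh (zs a) (zs b) = sh_basis a b.
Proof. by move=> a0 b0; rewrite /sh /bilin_ext !lin_ext_zs. Qed.

Lemma word_blocks (w : {fmonom bool}) :
  last true w -> word (blocks 0 w) = w.
Proof.
have E s k : last false s ->
    flatten [seq rcons (nseq j.-1 false) true | j <- blocks k s]
    = nseq k false ++ s.
  elim: s k => [//|[] s IH] k /= ls; last first.
    by rewrite (IH k.+1 ls) -cat_rcons -cats1 -(nseqD k 1) addn1.
  case: s IH ls => [|x s] IH ls; first by rewrite cats0 cats1.
  by rewrite (IH 0%N ls) cat_rcons.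
move=> lw; rewrite /word -[RHS]fmK; congr FMonom.
by case: (fmonom_val w) lw => // x s ls; rewrite (E _ 0%N).
Qed.

Lemma blocks_gt0 k (w : seq bool) : all (leq 1) (blocks k w).
Proof. by elim: w k => [|[] w IH] k //=. Qed.

(* Spanning half of the basis property; independence follows from H1val_zs  *)
(* and blocks_word.                                                           *)
Lemma H1_span (h : H1) :
  h = \sum_(w <- msupp (H1val h)) (H1val h)@_w *: zs (blocks 0 w).
Proof.
apply: val_inj; rewrite /= linear_sum [LHS]monalgE big_seq [RHS]big_seq.
apply: eq_bigr => w wh; rewrite linearZ /= H1val_zs word_blocks.
  by apply/malgP => k; rewrite mcoeffZ !mcoeffU mulr_natr.
by move/allP: (H1valP h) => ->.
Qed.

(* Main.v *)
Require Import Defs.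
From HB Require Import structures.
From mathcomp Require Import all_boot all_algebra.
From mathcomp.multinomials Require Import monalg.
From mathcomp Require Import finmap qpoly zify ring.

Set Implicit Arguments.
Unset Strict Implicit.
Unset Printing Implicit Defensive.

Import GRing.Theory.
Local Open Scope ring_scope.

(* Send z_{a_1} ... z_{a_r} to the quasisymmetric polynomial                  *)
(* sum_{N > i_1 > ... > i_r} x_{i_1}^{a_1} ... x_{i_r}^{a_r}. This turns star *)
(* into the ordinary product, it is jointly injective when N varies, and d    *)
(* replaces the strict inequalities by weak ones. Let s mark the letters z_c  *)
(* and t the pairs z_a z_b, and put M(x) = (s x^c, t x^a; x^b, s x^c). Then   *)
(* the series of z_c^i sh (z_a z_b)^j is the upper left entry of the product  *)
(* of the matrices 1 + M(x_i), the series of their images under d is that of  *)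
(* the product of the (1 - M(x_i))^-1, and the series of the second factors   *)
(* on the left-hand side is the product of the                                *)
(* det (1 - M(x_i)) / (1 - t x_i^(a+b)). Since (1 - M) adj (1 - M) is         *)
(* det (1 - M) and adj (1 - M) is 1 + M with s replaced by -s, the left-hand  *)
(* side becomes the first series at -s times that of d(z_{a+b}^k). Formal     *)
(* power series are replaced by nilpotent s and t, whose exponents m and n    *)
(* are the last ones with a nonzero power.                                    *)

(** * Maps between ordinals as lists *)

(** The sums over maps are first turned into recursions on the first letter ([qbasis_cons],
    [d_basis_cons]). Under evaluation these become recursions on the largest variable ([ev_cons],
    [ev_d_cons]), [star] becomes multiplication ([ev_star]), and comparing evaluations is enough
    ([ev_inj]). The identity then reads $DF=AE$ for four generating series: $D$ and $F$ for the two
    factors on the left, $A$ and $E$ for those on the right. One more variable changes each of them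
    by an explicit matrix or scalar, and [transfer_step] checks by 2 by 2 linear algebra that the
    equality persists; [transfer] starts the induction from $1=1$ without variables. The theorem is
    the coefficient of $s^m t^n$, extracted by [nilpotent_ext2]. *)

Definition vals (p K : nat) (u : {ffun 'I_p -> 'I_K}) : seq nat :=
  [seq val (u i) | i <- enum 'I_p].

Lemma size_vals p K (u : {ffun 'I_p -> 'I_K}) : size (vals u) = p.
Proof. by rewrite size_map size_enum_ord. Qed.

Lemma nth_vals p K (u : {ffun 'I_p -> 'I_K}) (i : 'I_p) :
  nth 0%N (vals u) i = u i.
Proof.
by rewrite (nth_map i) ?size_enum_ord // nth_ord_enum.
Qed.

Lemma vals_inj p K : injective (@vals p K).
Proof.
move=> u v e; apply/ffunP => i; apply: val_inj => /=.
by rewrite -!nth_vals e.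
Qed.

Lemma mem_vals p K (u : {ffun 'I_p -> 'I_K}) (i : 'I_K) :
  (val i \in vals u) = (i \in u @: setT).
Proof.
apply/mapP/imsetP => [[k _ e]|[k _ ->]]; last by exists k; rewrite ?mem_enum.
by exists k => //; apply: val_inj.
Qed.

Lemma all_vals p K (u : {ffun 'I_p -> 'I_K}) : all (ltn^~ K) (vals u).
Proof. by apply/allP => _ /mapP[i _ ->] /=. Qed.

Lemma vals_surj p K (s : seq nat) :
  size s = p -> all (ltn^~ K) s -> exists u : {ffun 'I_p -> 'I_K}, vals u = s.
Proof.
move=> sz /allP sK.
have K0 (i : 'I_p) : (nth 0%N s i < K)%N by apply/sK/mem_nth; rewrite sz.
exists [ffun i => Ordinal (K0 i)].
apply: (@eq_from_nth _ 0%N); rewrite size_vals // => i ip.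
by rewrite (nth_vals _ (Ordinal ip)) ffunE.
Qed.

(** Lets recursively built lists such as [incs], [surjs] and [boxes] replace the finite functions of
    the definitions. *)
Lemma big_vals (V : nmodType) p K (P : pred (seq nat)) (L : seq (seq nat))
    (F : seq nat -> V) :
    uniq L ->
    (forall s, (s \in L) = [&& size s == p, all (ltn^~ K) s & P s]) ->
  \sum_(u : {ffun 'I_p -> 'I_K} | P (vals u)) F (vals u) = \sum_(s <- L) F s.
Proof.
move=> uL mL.
rewrite -big_filter -(big_map (@vals p K) xpredT F) /=.
apply: perm_big; apply: uniq_perm => // [|s].
  by rewrite map_inj_uniq ?filter_uniq ?index_enum_uniq //; apply: vals_inj.
rewrite mL; apply/mapP/and3P => [[u + ->]|[/eqP sz sK Ps]].
  by rewrite mem_filter => /andP[Pu _]; rewrite size_vals all_vals.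
have [u eu] := vals_surj sz sK; exists u => //.
by rewrite mem_filter eu Ps mem_index_enum.
Qed.

(** Value lists of the strictly increasing maps. If 0 is attained, it is the first value and the
    others are shifted by one; otherwise all values are shifted. *)
Fixpoint incs (m l : nat) : seq (seq nat) :=
  if l is l'.+1 then
    (if m is m'.+1 then [seq 0%N :: map S s | s <- incs m' l'] else [::])
      ++ [seq map S s | s <- incs m l']
  else if m is 0%N then [:: [::]] else [::].

Lemma map_succ_inj : injective (map S).
Proof. exact: inj_map succn_inj. Qed.

Lemma incs_uniq m l : uniq (incs m l).
Proof.
elim: l m => [|l IH] [|m] //=.
  by rewrite map_inj_uniq ?IH //; apply: map_succ_inj.
rewrite cat_uniq !map_inj_uniq ?IH ?andbT //=; first last.
- by move=> s t [/map_succ_inj].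
- exact: map_succ_inj.
apply/hasPn => _ /mapP[s _ ->]; apply/negP => /mapP[t _].
by case: s.
Qed.

Lemma map_succP (s : seq nat) : 0%N \notin s -> s = map S (map predn s).
Proof.
move=> s0; rewrite -map_comp map_id_in // => -[|i] //=.
by rewrite (negPf s0).
Qed.

Lemma mem_map_succ (L : seq (seq nat)) (s : seq nat) :
  (map S s \in map (map S) L) = (s \in L).
Proof. by rewrite mem_map //; apply: map_succ_inj. Qed.

Lemma sorted_map_succ (r : rel nat) (s : seq nat) :
  (forall i j, r i.+1 j.+1 = r i j) -> sorted r (map S s) = sorted r s.
Proof.
by move=> rS; case: s => //= x s; elim: s x => //= y s IH x; rewrite rS IH.
Qed.

Lemma zero_map_succ (s : seq nat) : (0%N \in map S s) = false.
Proof. by elim: s. Qed.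

Lemma mem_incs m l s :
  (s \in incs m l) = [&& size s == m, all (ltn^~ l) s & sorted ltn s].
Proof.
elim: l m s => [|l IH] m s /=.
  by case: m s => [|m] [|x s]; rewrite ?in_nil ?inE //= andbF.
rewrite mem_cat; case: (boolP (0%N \in s)) => [|s0].
  case: s => // x s; rewrite inE eq_sym => /orP[/eqP->|s0]; last first.
    have -> : (x :: s \in [seq map S s0 | s0 <- incs m l]) = false.
      by apply/mapP => -[t _ e]; move: (zero_map_succ t); rewrite -e inE s0 orbT.
    have -> : sorted ltn (x :: s) = false.
      rewrite /= (path_sortedE ltn_trans); apply/andP => -[/allP/(_ _ s0)].
      by rewrite ltn0.
    rewrite !andbF orbF; case: m => // m; apply/mapP => -[t _ [_ e]].
    by rewrite e zero_map_succ in s0.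
  have -> : (0%N :: s \in [seq map S s0 | s0 <- incs m l]) = false.
    by apply/mapP => -[[]].
  rewrite orbF; case: m => [|m] //=.
  rewrite (path_sortedE ltn_trans) eqSS.
  case: (boolP (0%N \in s)) => s0.
    rewrite [X in _ = _ && (_ && (X && _))](_ : _ = false) ?andbF /=; last first.
      by apply/allP => /(_ _ s0); rewrite ltnn.
    by apply/mapP => -[t _ [e]]; rewrite e zero_map_succ in s0.
  rewrite (map_succP s0); set t := map predn s.
  rewrite (mem_map (_ : injective (fun u => 0%N :: map S u))) ?IH; last first.
    by move=> u v [/map_succ_inj].
  rewrite sorted_map_succ // size_map all_map.
  rewrite [X in _ && (_ && (X && _))](_ : _ = true) //.
  by apply/allP => _ /mapP[i _ ->].
have -> : (s \in match m with 0 => [::] | m'.+1 =>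
    [seq 0%N :: map S s0 | s0 <- incs m' l] end) = false.
  case: m => // m; apply/mapP => -[t _ e].
  by rewrite e inE in s0.
rewrite (map_succP s0); set t := map predn s.
by rewrite mem_map_succ IH size_map all_map sorted_map_succ.
Qed.

Lemma incr_vals p K (u : {ffun 'I_p -> 'I_K}) : incr u = sorted ltn (vals u).
Proof.
apply/forallP/idP => [h|/(sortedP 0%N) h i].
  apply/(sortedP 0%N) => i; rewrite size_vals => ip.
  rewrite (nth_vals u (Ordinal (ltnW ip))) (nth_vals u (Ordinal ip)).
  by move/forallP: (h (Ordinal (ltnW ip))) => /(_ (Ordinal ip)); rewrite /= ltnSn.
apply/forallP => j; apply/implyP => ij; rewrite -!nth_vals.
apply: (sorted_ltn_nth ltn_trans) => //; rewrite ?inE ?size_vals //.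
exact/(sortedP 0%N).
Qed.

Lemma nondecr_vals p K (u : {ffun 'I_p -> 'I_K}) :
  nondecr u = sorted leq (vals u).
Proof.
apply/forallP/idP => [h|/(sortedP 0%N) h i].
  apply/(sortedP 0%N) => i; rewrite size_vals => ip.
  rewrite (nth_vals u (Ordinal (ltnW ip))) (nth_vals u (Ordinal ip)).
  by move/forallP: (h (Ordinal (ltnW ip))) => /(_ (Ordinal ip)); rewrite /= leqnSn.
apply/forallP => j; apply/implyP => ij; rewrite -!nth_vals.
apply: (sorted_leq_nth leq_trans leqnn) => //; rewrite ?inE ?size_vals //.
exact/(sortedP 0%N).
Qed.

Definition part (a s : seq nat) (i : nat) : nat :=
  \sum_(p <- zip a s | p.2 == i) p.1.

Lemma part_vals (a : seq nat) l (s : {ffun 'I_(size a) -> 'I_l}) (i : 'I_l) :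
  (\sum_(k < size a | s k == i) nth 0 a k)%N = part a (vals s) i.
Proof.
rewrite /part (big_nth (0, 0)%N) size_zip size_vals minnn big_mkord.
by apply: eq_big => [k|k _]; rewrite nth_zip ?size_vals //= nth_vals.
Qed.

Definition covers (l : nat) (s : seq nat) := all (mem s) (iota 0 l).

Lemma covers_vals p l (s : {ffun 'I_p -> 'I_l}) :
  (s @: setT == setT) = covers l (vals s).
Proof.
apply/eqP/allP => [e i|h].
  rewrite mem_iota add0n => /= il; rewrite /in_mem /=.
  by have:= mem_vals s (Ordinal il); rewrite e inE.
apply/setP => i; rewrite inE -mem_vals.
by have := h i; rewrite mem_iota add0n ltn_ord => /(_ isT).
Qed.

Lemma covers2_vals p q l (s : {ffun 'I_p -> 'I_l}) (t : {ffun 'I_q -> 'I_l}) :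
  (s @: setT :|: t @: setT == setT) = covers l (vals s ++ vals t).
Proof.
apply/eqP/allP => [e i|h].
  rewrite mem_iota add0n => /= il; change (i \in vals s ++ vals t).
  rewrite mem_cat.
  by rewrite (mem_vals s (Ordinal il)) (mem_vals t (Ordinal il)) -in_setU e inE.
apply/setP => i; rewrite !inE -!mem_vals -mem_cat.
by have := h i; rewrite mem_iota add0n ltn_ord => /(_ isT).
Qed.

Lemma disj_vals p q l (s : {ffun 'I_p -> 'I_l}) (t : {ffun 'I_q -> 'I_l}) :
  (s @: setT :&: t @: setT == set0) = ~~ has (mem (vals s)) (vals t).
Proof.
apply/eqP/hasPn => [e _ /mapP[i _ ->]|h].
  apply/negP; change (val (t i) \in vals s -> False); rewrite mem_vals => si.
  have: t i \in s @: setT :&: t @: setT by rewrite inE si imset_f ?inE.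
  by rewrite e inE.
apply/setP => i; rewrite !inE -!mem_vals.
by case: (boolP (val i \in vals t)) => [/h /negPf|]; rewrite ?andbF ?andbT.
Qed.

Lemma map_enum_ord (l : nat) (g : nat -> nat) :
  [seq g (val i) | i <- enum 'I_l] = [seq g i | i <- iota 0 l].
Proof. by rewrite (map_comp g val) val_enum_ord. Qed.

Definition merge_seq (a b : seq nat) (l : nat) (s t : seq nat) : seq nat :=
  [seq (part a s i + part b t i)%N | i <- iota 0 l].

Lemma merge_vals a b l (s : {ffun 'I_(size a) -> 'I_l})
    (t : {ffun 'I_(size b) -> 'I_l}) :
  merge_parts s t = merge_seq a b l (vals s) (vals t).
Proof.
rewrite /merge_seq.
rewrite -(map_enum_ord l (fun i => part a (vals s) i + part b (vals t) i)%N).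
by apply: eq_map => i; rewrite !part_vals.
Qed.

Arguments part : simpl never.
Arguments covers : simpl never.
Arguments merge_seq : simpl never.

(* [phi] tells whether the images of the two maps may meet: [true] gives the  *)
(* product [star] and [false] the product [sh].                               *)
Definition qterm (phi : bool) (a b : seq nat) (l : nat) : H1 :=
  \sum_(s <- incs (size a) l)
    \sum_(t <- incs (size b) l
         | covers l (s ++ t) && (phi || ~~ has (mem s) t))
      zs (merge_seq a b l s t).

Definition qbasis (phi : bool) (a b : seq nat) : H1 :=
  \sum_(l < (size a + size b).+1) qterm phi a b l.

Lemma qtermE phi a b l :
  \sum_(s : {ffun 'I_(size a) -> 'I_l})
      \sum_(t : {ffun 'I_(size b) -> 'I_l} |
              [&& incr s, incr t & (s @: setT :|: t @: setT == setT)
                 && (phi || (s @: setT :&: t @: setT == set0))])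
        zs (merge_parts s t) = qterm phi a b l.
Proof.
rewrite /qterm -(big_vals (P := sorted ltn) _ (incs_uniq _ _) (mem_incs _ _)).
rewrite [RHS]big_mkcond; apply: eq_bigr => s _ /=.
rewrite incr_vals; case: ifP => _ /=; last by rewrite big_pred0.
rewrite [RHS]big_mkcond.
rewrite -(big_vals (P := sorted ltn) _ (incs_uniq _ _) (mem_incs _ _)).
rewrite [RHS]big_mkcond [LHS]big_mkcond /=; apply: eq_bigr => t _ /=.
rewrite incr_vals covers2_vals disj_vals merge_vals.
by case: (sorted _ _).
Qed.

Lemma star_basisE a b : star_basis a b = qbasis true a b.
Proof.
apply: eq_bigr => l _; rewrite -qtermE; apply: eq_bigr => s _.
by apply: eq_bigl => t; rewrite andbT.
Qed.

Lemma sh_basisE a b : sh_basis a b = qbasis false a b.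
Proof. by apply: eq_bigr => l _; rewrite -qtermE. Qed.

(** * Recursion on the first letter *)

Lemma iota_succ l : iota 0 l.+1 = 0%N :: map S (iota 0 l).
Proof. by rewrite /= (iotaDl 1 0 l). Qed.

Lemma part_map_succ a s i : part a (map S s) i.+1 = part a s i.
Proof.
rewrite /part; elim: a s => [|k a IH] [|x s] /=; rewrite ?big_nil //.
by rewrite !big_cons IH eqSS.
Qed.

Lemma part_map_succ0 a s : part a (map S s) 0 = 0%N.
Proof.
rewrite /part; elim: a s => [|k a IH] [|x s] /=; rewrite ?big_nil //.
by rewrite big_cons IH.
Qed.

Lemma part_cons0 k a s i :
  part (k :: a) (0%N :: s) i = ((i == 0%N) * k + part a s i)%N.
Proof. by rewrite /part /= big_cons eq_sym /=; case: eqP => //=; rewrite mul1n. Qed.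

Lemma part_nil s i : part [::] s i = 0%N.
Proof. by rewrite /part; case: s => [|x s]; rewrite big_nil. Qed.

Lemma merge_succ (g : nat -> nat) l :
  [seq g i | i <- iota 0 l.+1] = g 0%N :: [seq g i.+1 | i <- iota 0 l].
Proof. by rewrite iota_succ /= -map_comp. Qed.

Lemma mem_map_S (s : seq nat) i : (i.+1 \in map S s) = (i \in s).
Proof. by rewrite mem_map //; apply: succn_inj. Qed.

Lemma covers_succ l s :
  covers l.+1 s = (0%N \in s) && all (fun i => i.+1 \in s) (iota 0 l).
Proof. by rewrite /covers iota_succ /= all_map. Qed.

Lemma has_map_succ (s t : seq nat) :
  has (mem (map S s)) (map S t) = has (mem s) t.
Proof. by rewrite has_map; apply: eq_has => i /=; apply: mem_map_S. Qed.

Lemma has_cons0_map_succ (s t : seq nat) :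
  has (mem (0%N :: map S s)) (map S t) = has (mem s) t.
Proof.
rewrite has_map; apply: eq_has => i /=.
by change ((i.+1 \in 0%N :: map S s) = (i \in s)); rewrite inE mem_map_S.
Qed.

Lemma zs_cons k w : zs (k :: w) = z k * zs w.
Proof. exact: big_cons. Qed.

(** The value 0 is attained by the first map only, by the second only, or by both, which gives the
    three terms; the last case is excluded for [sh]. *)
Lemma qtermS phi k a j b l :
  qterm phi (k :: a) (j :: b) l.+1 =
    z k * qterm phi a (j :: b) l + z j * qterm phi (k :: a) b l
      + (if phi then z (k + j)%N * qterm phi a b l else 0).
Proof.
rewrite /qterm /= !big_cat /= !big_map /=.
under eq_bigr => s _ do rewrite big_cat /= !big_map /=.
under [X in _ + X]eq_bigr => s _ do rewrite big_cat /= !big_map /=.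
rewrite !big_split /=.
(* Neither map attains 0, so they do not cover. *)
rewrite [X in _ + _ + (_ + X)]big1 => [|s _]; last first.
  by apply: big_pred0 => t; rewrite covers_succ mem_cat !zero_map_succ.
rewrite addr0 -addrA addrC -!addrA; congr (_ + _); last congr (_ + _).
- rewrite mulr_sumr; apply: eq_bigr => s _.
  rewrite mulr_sumr; apply: eq_big => [t|t _].
    rewrite has_cons0_map_succ covers_succ inE /=; congr (_ && _).
    by apply: eq_all => i; rewrite inE -map_cat mem_map_S.
  rewrite -zs_cons /merge_seq merge_succ part_cons0 !part_map_succ0 /=.
  rewrite mul1n !addn0; congr (zs (_ :: _)); apply: eq_map => i.
  by rewrite part_cons0 !part_map_succ.
- rewrite mulr_sumr; apply: eq_bigr => s _.
  rewrite mulr_sumr; apply: eq_big => [t|t _].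
    rewrite zero_map_succ has_map_succ covers_succ mem_cat inE /=.
    rewrite orbT; congr (_ && _).
    by apply: eq_all => i; rewrite mem_cat inE -mem_cat -map_cat mem_map_S.
  rewrite -zs_cons /merge_seq merge_succ part_cons0 !part_map_succ0 /=.
  rewrite mul1n !addn0 add0n; congr (zs (_ :: _)); apply: eq_map => i.
  by rewrite part_cons0 !part_map_succ.
case: phi => /=; last first.
  by rewrite big1 // => s _; apply: big_pred0 => t; rewrite /= andbF.
rewrite mulr_sumr; apply: eq_bigr => s _.
rewrite mulr_sumr; apply: eq_big => [t|t _].
  rewrite !andbT covers_succ inE /=.
  apply: eq_all => i; rewrite inE mem_cat inE -mem_cat -map_cat.
  by rewrite mem_map_S.
rewrite -zs_cons /merge_seq merge_succ !part_cons0 !part_map_succ0 /=.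
rewrite !mul1n !addn0; congr (zs (_ :: _)); apply: eq_map => i.
by rewrite !part_cons0 !part_map_succ.
Qed.

Lemma qtermS0 phi k a l :
  qterm phi (k :: a) [::] l.+1 = z k * qterm phi a [::] l.
Proof.
have incs0 n : incs 0 n = [:: [::]] by elim: n => //= n ->.
rewrite /qterm /= !big_cat /= !big_map !incs0 /=.
rewrite [X in _ + X]big1 => [|s _]; last first.
  by rewrite big_mkcond big_seq1 covers_succ cats0 zero_map_succ.
rewrite addr0 mulr_sumr; apply: eq_bigr => s _.
rewrite big_mkcond big_seq1 [in RHS]big_mkcond big_seq1 !cats0 covers_succ inE /=.
rewrite (eq_all (a2 := mem s)); last by move=> i; rewrite inE mem_map_S.
rewrite /covers; case: ifP => _; last by rewrite mulr0.
rewrite -zs_cons /merge_seq merge_succ part_cons0 !part_map_succ0 /= mul1n addn0.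
rewrite part_nil addn0; congr (zs (_ :: _)); apply: eq_map => i.
by rewrite part_cons0 part_map_succ !part_nil.
Qed.

Lemma qtermS0l phi k a l :
  qterm phi [::] (k :: a) l.+1 = z k * qterm phi [::] a l.
Proof.
have incs0 n : incs 0 n = [:: [::]] by elim: n => //= n ->.
rewrite /qterm !incs0 !big_seq1 /= big_cat /= !big_map /=.
rewrite [X in _ + X]big_pred0 => [|s]; last first.
  by rewrite covers_succ zero_map_succ.
rewrite addr0 mulr_sumr; apply: eq_big => [s|s _].
  rewrite covers_succ inE /= has_map; congr (_ && (_ || ~~ _)).
  by apply: eq_all => i; rewrite inE mem_map_S.
rewrite -zs_cons /merge_seq merge_succ part_cons0 !part_map_succ0 /= mul1n addn0.
rewrite part_nil add0n; congr (zs (_ :: _)); apply: eq_map => i.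
by rewrite part_cons0 part_map_succ !part_nil.
Qed.

Lemma qterm_nil phi l : qterm phi [::] [::] l = if l is 0%N then 1 else 0.
Proof.
have incs0 n : incs 0 n = [:: [::]] by elim: n => //= n ->.
rewrite /qterm !incs0 big_seq1 big_mkcond big_seq1.
by case: l => [|l]; rewrite /= ?orbT // /merge_seq /zs big_nil.
Qed.

Lemma qterm0 phi a b : qterm phi a b 0 = ((a == [::]) && (b == [::]))%:R.
Proof.
case: a => [|k a]; last by rewrite /qterm /= big_nil.
case: b => [|j b]; first exact: qterm_nil.
by rewrite /qterm /= big_seq1 big_nil.
Qed.

Lemma qterm_big phi a b l : (size a + size b < l)%N -> qterm phi a b l = 0.
Proof.
elim: l a b => // l IH [|k a] [|j b] /= ll; first by rewrite qterm_nil.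
- by rewrite qtermS0l IH ?mulr0.
- by rewrite qtermS0 IH ?mulr0.
rewrite qtermS !IH /= ?mulr0 ?add0r; try lia.
by case: ifP.
Qed.

Lemma qbasis_widen phi a b K : (size a + size b < K)%N ->
  qbasis phi a b = \sum_(l < K) qterm phi a b l.
Proof.
move=> sK; rewrite -(subnKC sK) big_split_ord /=.
rewrite [X in _ + X]big1 ?addr0 // => i _.
by rewrite qterm_big //=; lia.
Qed.

(** The usual recursive definition of the quasi-shuffle and shuffle products. *)
Lemma qbasis_cons phi k a j b :
  qbasis phi (k :: a) (j :: b) =
    z k * qbasis phi a (j :: b) + z j * qbasis phi (k :: a) b
      + (if phi then z (k + j)%N * qbasis phi a b else 0).
Proof.
rewrite /qbasis big_ord_recl qterm0 add0r /=.
under eq_bigr => i _ do rewrite qtermS.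
rewrite !big_split /= -!mulr_sumr addSn -/(qbasis phi a (j :: b)).
rewrite -(@qbasis_widen phi (k :: a) b) /=; last by lia.
congr (_ + _); case: phi; last by rewrite big1.
by rewrite -mulr_sumr -qbasis_widen //; lia.
Qed.

Lemma qbasis_nill phi b : qbasis phi [::] b = zs b.
Proof.
elim: b => [|k b IH].
  by rewrite /qbasis big_ord_recl big_ord0 qterm_nil addr0 /zs big_nil.
rewrite /qbasis big_ord_recl qterm0 add0r /=.
by under eq_bigr => i _ do rewrite qtermS0l;
  rewrite -mulr_sumr -/(qbasis phi [::] b) IH zs_cons.
Qed.

Lemma qbasis_nilr phi a : qbasis phi a [::] = zs a.
Proof.
elim: a => [|k a IH].
  by rewrite /qbasis big_ord_recl big_ord0 qterm_nil addr0 /zs big_nil.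
rewrite /qbasis big_ord_recl qterm0 add0r /=.
by under eq_bigr => i _ do rewrite qtermS0;
  rewrite -mulr_sumr -/(qbasis phi a [::]) IH zs_cons.
Qed.

(* Nondecreasing surjections onto [0, l), each given by its list of values.   *)
Fixpoint surjs (m l : nat) : seq (seq nat) :=
  match m, l with
  | 0%N, 0%N => [:: [::]]
  | m'.+1, l'.+1 => [seq 0%N :: map S s | s <- surjs m' l']
                     ++ [seq 0%N :: s | s <- surjs m' l]
  | _, _ => [::]
  end.

Lemma mem_surjs m l s :
  (s \in surjs m l) =
    [&& size s == m, all (ltn^~ l) s & sorted leq s && covers l s].
Proof.
elim: m l s => [|m IH] [|l] s /=.
- by case: s => [|x s]; rewrite inE //= andbF.
- by case: s => [|x s]; rewrite in_nil.
- by case: s => [|x s]; rewrite in_nil //= andbF.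
rewrite mem_cat covers_succ.
case: s => [|x s].
  rewrite (_ : _ \in _ = false); last by apply/mapP => -[].
  by rewrite (_ : _ \in _ = false); last by apply/mapP => -[].
case: x => [|x]; last first.
  rewrite (_ : _ \in _ = false); last by apply/mapP => -[].
  rewrite (_ : _ \in _ = false); last by apply/mapP => -[].
  rewrite /=; symmetry; apply/negbTE; apply/negP.
  rewrite (path_sortedE leq_trans) inE /=.
  by case/and5P => _ _ /andP[/allP h _] /h.
rewrite (@mem_map _ _ (cons 0%N)) => [|u v [] //]; rewrite IH /= eqSS.
rewrite (path_sortedE leq_trans).
rewrite (_ : all (leq 0) s = true) /=; last by apply/allP.
case: (boolP (0%N \in s)) => s0.
  rewrite (_ : _ \in _ = false) /=; last first.
    by apply/mapP => -[t _ [e]]; rewrite e zero_map_succ in s0.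
  by rewrite covers_succ s0.
rewrite covers_succ (negPf s0) /= !andbF orbF.
rewrite (map_succP s0); set t := map predn s.
rewrite (mem_map (_ : injective (fun u => 0%N :: map S u))); last first.
  by move=> u v [/map_succ_inj].
rewrite IH size_map all_map sorted_map_succ //; congr [&& _, _, _ & _].
by apply: eq_all => i; symmetry; apply: mem_map_S.
Qed.

Lemma surjs_uniq m l : uniq (surjs m l).
Proof.
elim: m l => [|m IH] [|l] //=.
rewrite cat_uniq !map_inj_uniq ?IH ?andbT /=; first last.
- by move=> s t [/map_succ_inj].
- by move=> s t [].
apply/hasPn => _ /mapP[s + ->]; rewrite mem_surjs covers_succ.
case/and4P => _ _ _ /andP[s0 _].
by apply/negP => /mapP[t _ [e]]; rewrite e zero_map_succ in s0.
Qed.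

Definition dterm (a : seq nat) (l : nat) : H1 :=
  \sum_(s <- surjs (size a) l) zs [seq part a s i | i <- iota 0 l].

Lemma d_basisE a : d_basis a = \sum_(l < (size a).+1) dterm a l.
Proof.
apply: eq_bigr => l _.
rewrite /dterm -(big_vals (P := fun s => sorted leq s && covers l s)
  _ (surjs_uniq _ _) (mem_surjs _ _)).
apply: eq_big => [s|s _]; first by rewrite nondecr_vals covers_vals.
rewrite -map_enum_ord; congr zs; apply: eq_map => i.
by rewrite part_vals.
Qed.

(** Either the second letter opens a new block, or it shares the block of the first and the two
    letters may be added beforehand. *)
Lemma dtermS k j a l :
  dterm (k :: j :: a) l.+1 =
    z k * dterm (j :: a) l + dterm ((k + j)%N :: a) l.+1.
Proof.
rewrite /dterm [surjs _ _]/= -/(surjs (size a).+1 l.+1) big_cat !big_map.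
rewrite mulr_sumr; congr (_ + _).
  apply: eq_bigr => s _; rewrite -zs_cons merge_succ part_cons0 part_map_succ0.
  rewrite mul1n addn0; congr (zs (_ :: _)); apply: eq_map => i.
  by rewrite part_cons0 part_map_succ.
rewrite !big_cat !big_map; congr (_ + _); apply: eq_bigr => s _;
  by congr zs; apply: eq_map => i; rewrite !part_cons0 mulnDr addnA.
Qed.

Lemma surjs_big m l : (m < l)%N -> surjs m l = [::].
Proof. by elim: m l => [|m IH] [|l] //= ml; rewrite !IH //; apply: ltnW. Qed.

Lemma d_basis_cons k j a :
  d_basis (k :: j :: a) = z k * d_basis (j :: a) + d_basis ((k + j)%N :: a).
Proof.
rewrite !d_basisE [LHS]big_ord_recl {1}/dterm /= big_nil add0r.
under eq_bigr => i _ do rewrite dtermS.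
rewrite big_split /= -mulr_sumr; congr (_ + _).
(* The two index ranges differ by one: the extra terms have more blocks than letters, or no block at
   all, and are empty sums. *)
rewrite big_ord_recr /= [in RHS]big_ord_recl /= {2}/dterm /=.
rewrite surjs_big // surjs_big // big_nil addr0.
by rewrite {2}/dterm /= big_nil add0r.
Qed.

Lemma d_basis_nil : d_basis [::] = 1.
Proof.
by rewrite d_basisE big_ord_recl big_ord0 addr0 /dterm big_seq1 /zs big_nil.
Qed.

Lemma d_basis1 k : d_basis [:: k] = z k.
Proof.
rewrite d_basisE !big_ord_recl big_ord0 addr0 {1}/dterm /= big_nil add0r.
rewrite /dterm /= big_seq1 part_cons0 /part /= big_nil mul1n addn0.
by rewrite /zs big_seq1.
Qed.

(** * Quasisymmetric evaluation *)

Lemma malg_scalerAr (K : monomType) (R : comNzRingType) (r : R)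
    (u v : {malg R[K]}) :
  u * (r *: v) = r *: (u * v).
Proof.
apply/malgP => w; rewrite mcoeffZ.
rewrite (mcoeffMlw _ (fsubset_refl _) (msuppZ_le _ _)) mcoeffMl mulr_sumr.
apply: eq_bigr => k _; rewrite mulr_sumr; apply: eq_bigr => l _.
by rewrite mcoeffZ mulrnAr mulrCA.
Qed.

Lemma H1_scalerAr (r : rat) (u v : H1) : u * (r *: v) = r *: (u * v).
Proof.
by apply: val_inj; rewrite /= malg_scalerAr.
Qed.

Lemma H1_lin_ind (P : H1 -> Prop) :
    P 0 -> (forall r u v, P u -> P v -> P (r *: u + v)) ->
    (forall w, all (leq 1) w -> P (zs w)) ->
  forall h, P h.
Proof.
move=> P0 PD Pz h; rewrite (H1_span h).
apply: (big_ind P) => // [u v Pu Pv|w _].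
  by rewrite -(scale1r u); apply: PD.
by rewrite -[X in P X]addr0; apply: PD => //; apply/Pz/blocks_gt0.
Qed.

(* The word [k_1, ..., k_r] is sent to the sum of                             *)
(* [x i_1 ^+ k_1 * ... * x i_r ^+ k_r] over all [N > i_1 > ... > i_r].        *)
Fixpoint evw (R : comNzRingType) (x : nat -> R) (N : nat) (w : seq nat) : R :=
  match N, w with
  | _, [::] => 1
  | 0%N, _ => 0
  | N'.+1, k :: w' => evw x N' w + x N' ^+ k * evw x N' w'
  end.

(** Rational coefficients enter through [f], which leaves [R] free to be a nested polynomial ring
    ([evw_dual]) or a nilpotent extension ([nilpotent_ext2]). *)
Definition ev (R : comNzRingType) (f : {rmorphism rat -> R}) (x : nat -> R)
    (N : nat) (h : H1) : R :=
  mmap f (fun w : {fmonom bool} => evw x N (blocks 0 w)) (H1val h).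

Lemma ev_is_zmod_morphism R f x N : zmod_morphism (@ev R f x N).
Proof. by move=> u v; rewrite /ev [H1val _]linearB [LHS]raddfB. Qed.

HB.instance Definition _ (R : comNzRingType) (f : {rmorphism rat -> R})
    (x : nat -> R) (N : nat) :=
  GRing.isZmodMorphism.Build H1 R (@ev R f x N) (ev_is_zmod_morphism f x N).

Lemma evZ R f x N r h : @ev R f x N (r *: h) = f r * ev f x N h.
Proof.
rewrite /ev linearZ /= (mmapEw (msuppZ_le _ _)) mmapE big_distrr /=.
by apply: eq_bigr => w _; rewrite mcoeffZ rmorphM mulrA.
Qed.

Lemma evP R f x N r u v :
  @ev R f x N (r *: u + v) = f r * ev f x N u + ev f x N v.
Proof. by rewrite raddfD /= evZ. Qed.

Lemma evw_nil (R : comNzRingType) (x : nat -> R) N : evw x N [::] = 1.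
Proof. by case: N. Qed.

Lemma ev_zs R f x N w : all (leq 1) w -> @ev R f x N (zs w) = evw x N w.
Proof. by move=> w0; rewrite /ev H1val_zs mmapU /= rmorph1 mul1r blocks_word. Qed.

Lemma ev1 R f x N : @ev R f x N 1 = 1.
Proof. by have := @ev_zs R f x N [::] isT; rewrite evw_nil /zs big_nil. Qed.

Lemma ev0_cons R f x k h : (0 < k)%N -> @ev R f x 0 (z k * h) = 0.
Proof.
move=> k0; elim/H1_lin_ind: h => [|r u v Pu Pv|w w0].
- by rewrite mulr0 raddf0.
- by rewrite mulrDr H1_scalerAr (evP _ _ _ r) Pu Pv mulr0 addr0.
- by rewrite -zs_cons ev_zs //= k0.
Qed.

Lemma ev_cons R f x N k h : (0 < k)%N ->
  @ev R f x N.+1 (z k * h) = ev f x N (z k * h) + x N ^+ k * ev f x N h.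
Proof.
move=> k0; elim/H1_lin_ind: h => [|r u v Pu Pv|w w0].
- by rewrite mulr0 !raddf0 mulr0 addr0.
- rewrite mulrDr H1_scalerAr; move: (z k * u) (z k * v) Pu Pv => u' v' Pu Pv.
  by rewrite !evP Pu Pv; ring.
- by rewrite -zs_cons !ev_zs //= ?k0.
Qed.

Lemma sh_cons k u j v :
    all (leq 1) (k :: u) -> all (leq 1) (j :: v) ->
  sh (zs (k :: u)) (zs (j :: v)) =
    z k * sh (zs u) (zs (j :: v)) + z j * sh (zs (k :: u)) (zs v).
Proof.
move=> /[dup] ku0 /andP[_ u0] /[dup] jv0 /andP[_ v0].
by rewrite !sh_zs // !sh_basisE qbasis_cons addr0.
Qed.

Lemma sh_nill v : all (leq 1) v -> sh (zs [::]) (zs v) = zs v.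
Proof. by move=> v0; rewrite sh_zs // sh_basisE qbasis_nill. Qed.

Lemma sh_nilr u : all (leq 1) u -> sh (zs u) (zs [::]) = zs u.
Proof. by move=> u0; rewrite sh_zs // sh_basisE qbasis_nilr. Qed.

Lemma ev_star_zs R f x N u v :
    all (leq 1) u -> all (leq 1) v ->
  @ev R f x N (star (zs u) (zs v)) = evw x N u * evw x N v.
Proof.
move=> u0 v0; rewrite star_zs // star_basisE.
elim: N u v u0 v0 => [|N IH] [|k u] [|j v] u0 v0;
  rewrite ?qbasis_nill ?qbasis_nilr ?ev_zs ?evw_nil ?mul1r ?mulr1 //.
  rewrite qbasis_cons !raddfD /= !ev0_cons ?addr0 ?mulr0 //;
    move: u0 v0 => /= /andP[k0 _] /andP[j0 _] //; lia.
have /andP[k0 u0'] := u0; have /andP[j0 v0'] := v0.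
have kj0 : (0 < k + j)%N by lia.
(* This instance, expanded by [qbasis_cons], accounts for all the terms free of [x N] at once; the
   other instances concern shorter words. *)
have := IH _ _ u0 v0.
have evwS i w : evw x N.+1 (i :: w) = evw x N (i :: w) + x N ^+ i * evw x N w.
  by [].
rewrite !evwS qbasis_cons !raddfD /= !ev_cons // !IH // exprD.
move: (ev _ _ _ _) (ev _ _ _ _) (ev _ _ _ _) => A B C e.
by rewrite mulrDl !mulrDr -e; ring.
Qed.

Lemma ev_star R f x N g h :
  @ev R f x N (star g h) = ev f x N g * ev f x N h.
Proof.
elim/H1_lin_ind: g => [|r u v Pu Pv|w w0].
- by rewrite /star /bilin_ext !raddf0 mul0r.
- have -> : star (r *: u + v) h = r *: star u h + star v h.
    exact: bilin_ext_linear_l.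
  move: (star u h) (star v h) Pu Pv => u' v' Pu Pv.
  by rewrite !evP Pu Pv mulrDl mulrA.
have lin := bilin_ext_linear_r star_basis (zs w).
elim/H1_lin_ind: h => [|r u v Pu Pv|w' w0'].
- have := lin (-1) 0 0; rewrite scaler0 addr0 scaleN1r addNr => e.
  by rewrite [star _ _]e !raddf0 mulr0.
- have -> : star (zs w) (r *: u + v) = r *: star (zs w) u + star (zs w) v.
    exact: lin.
  move: (star _ u) (star _ v) Pu Pv => u' v' Pu Pv.
  by rewrite !evP Pu Pv; ring.
- by rewrite ev_star_zs // !ev_zs.
Qed.

(** After [d] the indices decrease only weakly, so the largest variable may be used again: the last
    factor keeps [N.+1] variables, unlike in [ev_cons]. On words, reusing it for the next letter is
    the merging term of [d_basis_cons]. *)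
Lemma ev_d_cons R f x N k h : (0 < k)%N ->
  @ev R f x N.+1 (d (z k * h))
    = ev f x N (d (z k * h)) + x N ^+ k * ev f x N.+1 (d h).
Proof.
move=> k0; elim/H1_lin_ind: h => [|r u v Pu Pv|w w0].
- by rewrite mulr0 !raddf0 mulr0 addr0.
- rewrite mulrDr H1_scalerAr (linearP d r u v) (linearP d r (z k * u)) /=.
  move: (d u) (d v) (d (z k * u)) (d (z k * v)) Pu Pv => du dv u' v' Pu Pv.
  by rewrite !evP Pu Pv; ring.
rewrite -zs_cons !d_zs /= ?k0 //.
elim: w k k0 w0 => [|j w IH] k k0 w0.
  by rewrite d_basis1 d_basis_nil -[z k]mulr1 ev_cons // !ev1.
have /andP[j0 w0'] := w0.
rewrite d_basis_cons !raddfD /= ev_cons // !IH ?addn_gt0 ?k0 // exprD.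
ring.
Qed.

Lemma ev0_d_cons R f x k h : (0 < k)%N -> @ev R f x 0 (d (z k * h)) = 0.
Proof.
move=> k0; elim/H1_lin_ind: h => [|r u v Pu Pv|w w0].
- by rewrite mulr0 !raddf0.
- rewrite mulrDr H1_scalerAr (linearP d r (z k * u)) /=.
  move: (d (z k * u)) (d (z k * v)) Pu Pv => u' v' Pu Pv.
  by rewrite evP Pu Pv mulr0 addr0.
rewrite -zs_cons !d_zs /= ?k0 //.
elim: w k k0 w0 => [|j w IH] k k0 w0.
  by rewrite d_basis1 -[z k]mulr1 ev0_cons.
have /andP[j0 w0'] := w0.
by rewrite d_basis_cons raddfD /= ev0_cons // add0r IH // addn_gt0 k0.
Qed.

Lemma ev_rmorph (R R' : comNzRingType) (g : {rmorphism R -> R'})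
    (f : {rmorphism rat -> R}) (x : nat -> R) N h :
  ev (g \o f) (g \o x) N h = g (ev f x N h).
Proof.
rewrite /ev /mmap rmorph_sum; apply: eq_bigr => w _ /=.
rewrite rmorphM; congr (_ * _); elim: N (blocks _ _) => [|N IH] [|k u] /=;
  rewrite ?rmorph1 ?rmorph0 //.
by rewrite !IH rmorphD rmorphM rmorphXn.
Qed.

(* Exponents of x_(N-1) are read off as coefficients in the outermost of N    *)
(* nested polynomial rings.                                                   *)
Lemma evw_dual (v : seq nat) : all (leq 1) v ->
  exists (R : comNzRingType) (f : {rmorphism rat -> R}) (x : nat -> R)
         (c : {additive R -> rat}),
    (forall r y, c (f r * y) = r * c y) /\
    (forall w, all (leq 1) w -> c (evw x (size v) w) = (w == v)%:R).
Proof.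
elim: v => [_|k v IH /= /andP[k0 /IH[R [f [x [c [cZ cE]]]]]]].
  exists rat, (GRing.RMorphism.clone _ _ idfun _), (fun=> 0),
    (GRing.Additive.clone _ _ idfun _).
  by split=> // -[|k w].
(* The variables of the shorter word become constants, and the new largest one is the indeterminate.
   As [k] is positive, the coefficient of degree [k] only sees words whose first letter uses it. *)
pose x' i : {poly R} := if (i < size v)%N then (x i)%:P else 'X.
have x'E n w : (n <= size v)%N -> evw x' n w = (evw x n w)%:P.
  elim: n w => [|n IHn] [|j w] //= nv.
  by rewrite !IHn ?(ltnW nv) // /x' nv rmorphD rmorphM rmorphXn.
exists {poly R}, (GRing.RMorphism.clone _ _ (polyC \o f) _), x',
  (GRing.Additive.clone _ _ (c \o coefp k) _).
split=> [r p|[|j w]] /=; first by rewrite coefCM cZ.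
  by rewrite coef1 eqn0Ngt k0 raddf0.
move=> /andP[j0 w0]; rewrite !x'E // {1}/x' ltnn coefD coefC eqn0Ngt k0 add0r.
rewrite mulrC coefCM coefXn eqseq_cons [k == j]eq_sym.
by case: (j == k); rewrite ?mulr1 ?mulr0 ?raddf0 ?cE.
Qed.

(** For each word in the support, the functional of [evw_dual] recovers its coefficient from one
    evaluation. *)
Lemma ev_inj (h : H1) :
    (forall (R : comNzRingType) (f : {rmorphism rat -> R}) (x : nat -> R) N,
      ev f x N h = 0) ->
  h = 0.
Proof.
move=> h0; apply: val_inj => /=; apply/malgP => w; rewrite mcoeff0.
case: (boolP (w \in msupp (H1val h))) => [wh|/mcoeff_outdom //].
have lw : last true w by move/allP: (H1valP h); apply.
have [R [f [x [c [cZ cE]]]]] := evw_dual (blocks_gt0 0 w).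
have := congr1 c (h0 R f x (size (blocks 0 w))).
rewrite /ev /mmap !raddf_sum raddf0 (bigD1_seq w) //= cZ cE ?blocks_gt0 //.
rewrite eqxx mulr1 big_seq_cond big1 ?addr0 // => u /andP[uh uw].
rewrite cZ cE ?blocks_gt0 //; case: eqP => [e|_]; last by rewrite mulr0.
have lu : last true u by move/allP: (H1valP h); apply.
by rewrite -(word_blocks lu) -(word_blocks lw) e eqxx in uw.
Qed.

(** * Generating series *)

(** This is $R[X]/(X^{m+1})$, with [s] the class of $X$ and [c] the coefficient of $X^m$: higher
    degrees vanish in the ring and lower ones under [c], so [c] selects the total degree $m$ in a
    product of truncated series. *)
Lemma nilpotent_ext (R : comNzRingType) (m : nat) :
  exists (R' : comNzRingType) (C : {rmorphism R -> R'}) (s : R')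
         (c : {additive R' -> R}),
    s ^+ m.+1 = 0 /\ (forall i r, c (s ^+ i * C r) = (i == m)%:R * r).
Proof.
pose h : {poly R} := 'X^(m.+1).
(* The quotient is by [mk_monic h], which is [h] itself for a nonconstant monic polynomial. *)
have hE : mk_monic h = h by rewrite /h mk_monic_Xn.
have nilX : in_qpoly h 'X ^+ m.+1 = 0.
  rewrite -rmorphXn; apply: val_inj; rewrite /= hE.
  by rewrite Pdiv.RingMonic.rmodpp ?monicXn.
pose c (p : {poly %/ h}) : R := (p : {poly R})`_m.
have cB : zmod_morphism c by move=> p q; rewrite /c /= coefB.
pose cA : {additive {poly %/ h} -> R} :=
  HB.pack c (GRing.isZmodMorphism.Build _ _ c cB).
exists {poly %/ h}, (GRing.RMorphism.clone _ _ (qpolyC h) _), (in_qpoly h 'X), cA.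
split=> // i r.
have [im|mi] := leqP i m; last first.
  rewrite (gtn_eqF mi) mul0r -(subnKC mi) exprD nilX !mul0r raddf0 //.
have -> : in_qpoly h 'X ^+ i * qpolyC h r = in_qpoly h ('X^i * r%:P).
  rewrite rmorphM rmorphXn; congr (_ * _); apply: val_inj => /=.
  by rewrite Pdiv.CommonRing.rmodp_small // hE size_polyXn size_polyC; case: eqP.
rewrite /= /c in_qpoly_small.
  by rewrite mulrC coefCM coefXn mulrC eq_sym.
rewrite hE size_polyXn ltnS mulrC mul_polyC.
by apply: leq_trans (size_scale_leq _ _) _; rewrite size_polyXn.
Qed.

Lemma nilpotent_ext2 (R : comNzRingType) (m n : nat) :
  exists (R' : comNzRingType) (C : {rmorphism R -> R'}) (s t : R')
         (c : {additive R' -> R}),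
    [/\ s ^+ m.+1 = 0, t ^+ n.+1 = 0 &
     forall i j r, c (s ^+ i * t ^+ j * C r) = ((i == m) && (j == n))%:R * r].
Proof.
have [R1 [C1 [t [c1 [t0 c1E]]]]] := nilpotent_ext R n.
have [R2 [C2 [s [c2 [s0 c2E]]]]] := nilpotent_ext R1 m.
exists R2, (GRing.RMorphism.clone _ _ (C2 \o C1) _), s, (C2 t),
  (GRing.Additive.clone _ _ (c1 \o c2) _).
split=> //= [|i j r]; first by rewrite -rmorphXn t0 rmorph0.
rewrite -rmorphXn -mulrA -rmorphM c2E.
by case: (i == m); rewrite /= ?mul1r ?c1E // !mul0r raddf0.
Qed.

Definition gen1 (R : comNzRingType) (t : R) (n : nat) (f : nat -> R) : R :=
  \sum_(j < n.+1) t ^+ j * f j.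

Definition gen2 (R : comNzRingType) (s t : R) (m n : nat)
    (f : nat -> nat -> R) : R :=
  gen1 s m (fun i => gen1 t n (f i)).

Definition shift (V : nmodType) (f : nat -> V) (i : nat) : V :=
  if i is i'.+1 then f i' else 0.

Lemma eq_gen1 (R : comNzRingType) (t : R) n f g :
  f =1 g -> gen1 t n f = gen1 t n g.
Proof. by move=> e; apply: eq_bigr => i _; rewrite e. Qed.

Lemma gen1D (R : comNzRingType) (t : R) n f g :
  gen1 t n (fun j => f j + g j) = gen1 t n f + gen1 t n g.
Proof. by rewrite -big_split; apply: eq_bigr => j _; rewrite mulrDr. Qed.

Lemma gen1Z (R : comNzRingType) (t a : R) n f :
  gen1 t n (fun j => a * f j) = a * gen1 t n f.
Proof. by rewrite /gen1 mulr_sumr; apply: eq_bigr => j _; rewrite mulrCA. Qed.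

(** The one term on which truncation differs carries $t^{n+1}=0$. *)
Lemma gen1_shift (R : comNzRingType) (t : R) n f :
  t ^+ n.+1 = 0 -> gen1 t n (shift f) = t * gen1 t n f.
Proof.
move=> t0; rewrite /gen1 big_ord_recl mulr0 add0r [in RHS]big_ord_recr /=.
rewrite mulrDr mulrA -exprS t0 mul0r addr0 mulr_sumr; apply: eq_bigr => j _.
by rewrite exprS mulrA.
Qed.

Lemma gen1_delta (R : comNzRingType) (t : R) n f :
  (forall j, f j.+1 = 0) -> gen1 t n f = f 0%N.
Proof.
move=> f0; rewrite /gen1 big_ord_recl mul1r big1 ?addr0 // => j _.
by rewrite f0 mulr0.
Qed.

Lemma gen2_rec (R : comNzRingType) (s t X Y : R) m n f g h k :
    s ^+ m.+1 = 0 -> t ^+ n.+1 = 0 ->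
    (forall i j, f i j = g i j + X * shift (h^~ j) i + Y * shift (k i) j) ->
  gen2 s t m n f =
    gen2 s t m n g + s * X * gen2 s t m n h + t * Y * gen2 s t m n k.
Proof.
move=> s0 t0 fE; rewrite /gen2.
have -> : gen1 s m (fun i => gen1 t n (f i)) =
    gen1 s m (fun i => gen1 t n (g i)
      + X * shift (fun i' => gen1 t n (h i')) i + Y * (t * gen1 t n (k i))).
  apply: eq_gen1 => i; rewrite (eq_gen1 _ _ (fE i)) !gen1D !gen1Z gen1_shift //.
  congr (_ + _ * _ + _); case: i => [|i] //=.
  by rewrite /gen1 big1 // => j _; rewrite mulr0.
by rewrite !gen1D !gen1Z gen1_shift //; ring.
Qed.

(** Serves [cyc']: the mark [t] of a pair is paid when its [a] is removed, so removing [b] shifts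
    nothing. *)
Lemma gen2_rec0 (R : comNzRingType) (s t X Y : R) m n f g h k :
    s ^+ m.+1 = 0 ->
    (forall i j, f i j = g i j + X * shift (h^~ j) i + Y * k i j) ->
  gen2 s t m n f =
    gen2 s t m n g + s * X * gen2 s t m n h + Y * gen2 s t m n k.
Proof.
move=> s0 fE; rewrite /gen2.
have -> : gen1 s m (fun i => gen1 t n (f i)) =
    gen1 s m (fun i => gen1 t n (g i)
      + X * shift (fun i' => gen1 t n (h i')) i + Y * gen1 t n (k i)).
  apply: eq_gen1 => i; rewrite (eq_gen1 _ _ (fE i)) !gen1D !gen1Z.
  congr (_ + _ * _ + _); case: i => [|i] //=.
  by rewrite /gen1 big1 // => j _; rewrite mulr0.
by rewrite !gen1D !gen1Z gen1_shift //; ring.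
Qed.

Lemma gen2_delta (R : comNzRingType) (s t : R) m n f :
    (forall i j, f i.+1 j = 0) -> (forall j, f 0%N j.+1 = 0) ->
  gen2 s t m n f = f 0%N 0%N.
Proof.
move=> f0 f1; rewrite /gen2 gen1_delta ?gen1_delta // => i.
by rewrite /gen1 big1 // => j _; rewrite f0 mulr0.
Qed.

Lemma all_gt0_nseq c i : (0 < c)%N -> all (leq 1) (nseq i c).
Proof. by move=> c0; rewrite all_nseq c0 orbT. Qed.

Definition alt (a b j : nat) : seq nat := flatten (nseq j [:: a; b]).

Lemma all_gt0_alt a b j :
  (0 < a)%N -> (0 < b)%N -> all (leq 1) (alt a b j).
Proof. by move=> a0 b0; elim: j => //= j; rewrite a0 b0. Qed.

(* The two rows of the transfer matrix: the words of [cyc] alternate [a] and  *)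
(* [b] starting with [a], those of [cyc'] starting with [b].                  *)
Definition cyc (a b c i j : nat) : H1 := sh (zs (nseq i c)) (zs (alt a b j)).
Definition cyc' (a b c i j : nat) : H1 :=
  sh (zs (nseq i c)) (zs (b :: alt a b j)).

(* [psi'], [psi], [theta] abstract [ev N.+1], [ev N] and whichever of the two *)
(* (with or without [d]) is multiplied by the power of the last variable.     *)
Definition front_rec (R : comNzRingType) (X : R) (psi' psi theta : H1 -> R) :=
  forall k h, (0 < k)%N -> psi' (z k * h) = psi (z k * h) + X ^+ k * theta h.

(** The first letter of a shuffle is [c] or [a]. The last term concerns the empty word, on which
    [front_rec] says nothing; it vanishes in the induction step and gives the initial value in
    [gens0]. *)
Lemma cyc_rec (R : comNzRingType) (X : R) (psi' psi theta : {additive H1 -> R})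
    a b c i j :
    (0 < a)%N -> (0 < b)%N -> (0 < c)%N -> front_rec X psi' psi theta ->
  psi' (cyc a b c i j) = psi (cyc a b c i j)
    + X ^+ c * shift (fun i' => theta (cyc a b c i' j)) i
    + X ^+ a * shift (fun j' => theta (cyc' a b c i j')) j
    + (psi' 1 - psi 1) *+ ((i == 0%N) && (j == 0%N)).
Proof.
move=> a0 b0 c0 psiS.
have nc k := all_gt0_nseq k c0; have na k := all_gt0_alt k a0 b0.
have cn k : all (leq 1) (c :: nseq k c) by rewrite /= c0 nc.
have bn k : all (leq 1) (b :: alt a b k) by rewrite /= b0 na.
have an k : all (leq 1) (a :: b :: alt a b k) by rewrite /= a0 b0 na.
have altS k : alt a b k.+1 = a :: b :: alt a b k by [].
case: i j => [|i] [|j]; rewrite /cyc /cyc' /shift ?mulr0 ?addr0 ?altS.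
- by rewrite sh_nill // /zs big_nil mulr1n addrC subrK.
- by rewrite [nseq 0 c]/= !sh_nill // zs_cons psiS.
- by rewrite [alt a b 0]/= !sh_nilr // zs_cons psiS.
by rewrite [nseq i.+1 c]/= sh_cons // !raddfD /= !psiS //; ring.
Qed.

Lemma cyc'_rec (R : comNzRingType) (X : R)
    (psi' psi theta : {additive H1 -> R}) a b c i j :
    (0 < a)%N -> (0 < b)%N -> (0 < c)%N -> front_rec X psi' psi theta ->
  psi' (cyc' a b c i j) = psi (cyc' a b c i j)
    + X ^+ c * shift (fun i' => theta (cyc' a b c i' j)) i
    + X ^+ b * theta (cyc a b c i j).
Proof.
move=> a0 b0 c0 psiS.
have nc k := all_gt0_nseq k c0; have na k := all_gt0_alt k a0 b0.
have ab : all (leq 1) (b :: alt a b j) by rewrite /= b0 na.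
case: i => [|i]; rewrite /cyc /cyc' /= ?mulr0 ?addr0.
  by rewrite !sh_nill // zs_cons psiS.
have cn : all (leq 1) (c :: nseq i c) by rewrite /= c0 nc.
by rewrite sh_cons // !raddfD /= !psiS //; ring.
Qed.

(** * Shuffles of letters with indices in arithmetic progression *)

Fixpoint boxes (p K : nat) : seq (seq nat) :=
  if p is p'.+1 then [seq i :: s | i <- iota 0 K, s <- boxes p' K]
  else [:: [::]].

Lemma big_boxesS (V : nmodType) p K (F : seq nat -> V) :
  \sum_(s <- boxes p.+1 K) F s
    = \sum_(i <- iota 0 K) \sum_(s <- boxes p K) F (i :: s).
Proof. by rewrite /= big_allpairs_dep. Qed.

Lemma mem_boxes p K s : (s \in boxes p K) = (size s == p) && all (ltn^~ K) s.
Proof.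
elim: p s => [|p IH] [|x s] //=.
  by apply/allpairsP => -[[i t] []].
apply/allpairsP/idP => [[[i t] /= [iK tb [-> ->]]]|].
  by move: iK; rewrite mem_iota add0n eqSS => /= ->; rewrite -IH.
rewrite eqSS andbCA => /andP[xK sb].
by exists (x, s); rewrite /= mem_iota IH.
Qed.

Lemma boxes_uniq p K : uniq (boxes p K).
Proof.
elim: p => //= p IH; apply: allpairs_uniq; rewrite ?iota_uniq //.
by move=> [i s] [j t] _ _ /= [-> ->].
Qed.

Definition lift_exps (e c : nat) (u : seq nat) : seq nat :=
  [seq (e * i + c)%N | i <- u].

Lemma all_gt0_lift e c u : (0 < c)%N -> all (leq 1) (lift_exps e c u).
Proof. by move=> c0; apply/allP => _ /mapP[i _ ->]; lia. Qed.

(** Second factors of the left-hand side with [p] and [q] letters of the two kinds, [t] marking the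
    sum of all $u_k$ and $v_k$. Bounding these by [n] loses nothing once $t^{n+1}=0$. *)
Definition pairs (R : comNzRingType) (t : R) (n e c c' : nat) (psi : H1 -> R)
    (p q : nat) : R :=
  \sum_(u <- boxes p n.+1) \sum_(v <- boxes q n.+1)
    t ^+ (sumn u + sumn v)
      * psi (sh (zs (lift_exps e c u)) (zs (lift_exps e c' v))).

(** Inverse of $1-tX^e$ by [geoE]; it collects the choices of $u$ for a first letter $z_{eu+c}$ sent
    to $X^{eu+c}$. *)
Definition geo (R : comNzRingType) (t X : R) (n e : nat) : R :=
  \sum_(i <- iota 0 n.+1) (t * X ^+ e) ^+ i.

Lemma pairs_rec (R : comNzRingType) (t X : R)
    (psi' psi theta : {additive H1 -> R}) n e c c' p q :
    (0 < c)%N -> (0 < c')%N -> front_rec X psi' psi theta ->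
  pairs t n e c c' psi' p q = pairs t n e c c' psi p q
    + (X ^+ c * geo t X n e) * shift ((pairs t n e c c' theta)^~ q) p
    + (X ^+ c' * geo t X n e) * shift (pairs t n e c c' theta p) q
    + (psi' 1 - psi 1) *+ ((p == 0%N) && (q == 0%N)).
Proof.
move=> c0 c'0 psiS.
have uc u := all_gt0_lift e u c0; have vc v := all_gt0_lift e v c'0.
have kc i : (0 < e * i + c)%N by lia.
have kc' i : (0 < e * i + c')%N by lia.
have XE i k : X ^+ (e * i + k) = X ^+ k * (X ^+ e) ^+ i.
  by rewrite exprD exprM mulrC.
rewrite /pairs /geo; move: n.+1 => K.
case: p q => [|p] [|q]; rewrite [shift _ _]/= [shift _ _]/= ?mulr0 ?addr0.
- by rewrite !big_seq1 sh_nill // /zs big_nil !mul1r mulr1n addrC subrK.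
- rewrite !big_seq1 !big_boxesS mulr_sumr mulr_suml -big_split.
  apply: eq_bigr => i _ /=; rewrite mulr_sumr -big_split.
  apply: eq_bigr => v _ /=.
  rewrite !sh_nill ?vc //=; last by rewrite kc' vc.
  by rewrite zs_cons psiS // XE !exprD exprMn; ring.
- rewrite !big_boxesS mulr_sumr mulr_suml -big_split.
  apply: eq_bigr => i _ /=; rewrite mulr_sumr -big_split.
  apply: eq_bigr => u _ /=; rewrite !big_seq1.
  rewrite !sh_nilr ?uc //=; last by rewrite kc uc.
  by rewrite zs_cons psiS // XE !exprD exprMn; ring.
(* [A] and [B] are the terms whose first letter comes from [u] and from [v]. Both lists are nonempty
   here, so the default of [head] is never reached. *)
pose A u v := t ^+ (sumn u + sumn v) * (X ^+ (e * head 0 u + c)%N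
  * theta (sh (zs (lift_exps e c (behead u))) (zs (lift_exps e c' v)))).
pose B u v := t ^+ (sumn u + sumn v) * (X ^+ (e * head 0 v + c')%N
  * theta (sh (zs (lift_exps e c u)) (zs (lift_exps e c' (behead v))))).
have split u v : u \in boxes p.+1 K -> v \in boxes q.+1 K ->
  t ^+ (sumn u + sumn v)
    * psi' (sh (zs (lift_exps e c u)) (zs (lift_exps e c' v)))
  = t ^+ (sumn u + sumn v)
    * psi (sh (zs (lift_exps e c u)) (zs (lift_exps e c' v))) + A u v + B u v.
  rewrite !mem_boxes /A /B; case: u v => [|i u] [|j v] // _ _.
  rewrite [lift_exps e c _]/= [lift_exps e c' _]/= !sh_cons; first last.
  - by rewrite /= kc' vc.
  - by rewrite /= kc uc.
  rewrite !raddfD /= !psiS //; ring.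
under eq_big_seq => u ub do under eq_big_seq => v vb do rewrite split //.
under eq_bigr => u _ do rewrite !big_split.
rewrite ?mulr0n ?addr0 !big_split /=; congr (_ + _ + _).
  rewrite /A big_boxesS [X ^+ c * _]mulr_sumr mulr_suml.
  apply: eq_bigr => i _; rewrite mulr_sumr.
  apply: eq_bigr => u _; rewrite mulr_sumr.
  by apply: eq_bigr => v _ /=; rewrite XE !exprD exprMn; ring.
rewrite exchange_big /B big_boxesS [X ^+ c' * _]mulr_sumr mulr_suml.
apply: eq_bigr => i _; rewrite exchange_big mulr_sumr /=.
apply: eq_bigr => u _; rewrite mulr_sumr.
by apply: eq_bigr => v _ /=; rewrite XE !exprD exprMn; ring.
Qed.

(** * The transfer identity *)

Lemma inv_one_sub (R : comNzRingType) (y : R) k :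
  y ^+ k = 0 -> exists g, g * (1 - y) = 1.
Proof.
move=> y0; exists (\sum_(i < k) y ^+ i).
have := subrX1 y k; rewrite y0 sub0r => e.
by rewrite -[RHS]opprK e; ring.
Qed.

Lemma geoE (R : comNzRingType) (t X : R) n e :
  t ^+ n.+1 = 0 -> (1 - t * X ^+ e) * geo t X n e = 1.
Proof.
move=> t0; rewrite /geo -[iota _ _]/(index_iota 0 n.+1) big_mkord.
have := subrX1 (t * X ^+ e) n.+1; rewrite exprMn t0 mul0r sub0r => e1.
by rewrite -[RHS]opprK e1; ring.
Qed.

(* With [q = X ^+ c], one more variable multiplies the series of [d] by the   *)
(* inverse of the matrix [1 - M], [M = (s q, t xa; xb, s q)], while [F] picks *)
(* up [det (1 - M) / (1 - t xa xb)]; the product is the adjugate of [1 - M],  *)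
(* that is [1 + M] with [s] replaced by [-s], over [1 - t xa xb].             *)
Lemma transfer_step (R : comNzRingType) (s t q xa xb g : R) m n
    (D0 D1 D0' D1' F0 F1 A0 A1 A0' A1' E0 E1 : R) :
    s ^+ m.+1 = 0 -> t ^+ n.+1 = 0 -> (1 - t * (xa * xb)) * g = 1 ->
    D1 = D0 + s * q * D1 + t * xa * D1' ->
    D1' = D0' + s * q * D1' + xb * D1 ->
    F1 = F0 + - 2 * s * (q * g) * F0 + s ^+ 2 * (q ^+ 2 * g) * F0 ->
    A1 = A0 + - s * q * A0 + t * xa * A0' ->
    A1' = A0' + - s * q * A0' + xb * A0 ->
    E1 = E0 + t * (xa * xb) * E1 ->
    D0 * F0 = A0 * E0 -> D0' * F0 = A0' * E0 ->
  D1 * F1 = A1 * E1 /\ D1' * F1 = A1' * E1.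
Proof.
move=> s0 t0 gE D1E D1'E F1E -> -> E1E DA DA'.
pose u := t * (xa * xb); pose Delta := (1 - s * q) ^+ 2 - u.
have D0E : D0 = D1 - s * q * D1 - t * xa * D1'.
  by rewrite [X in X - _ - _]D1E; ring.
have D0'E : D0' = D1' - s * q * D1' - xb * D1.
  by rewrite [X in X - _ - _]D1'E; ring.
have E0E : E0 = E1 * (1 - u) by rewrite mulrBr mulr1 [X in X - _]E1E /u; ring.
(* Cramer's rule: [Delta] is the determinant of $1-M$. *)
have DD : D1 * Delta = (1 - s * q) * D0 + t * xa * D0'.
  by rewrite D0E D0'E /Delta /u; ring.
have DD' : D1' * Delta = (1 - s * q) * D0' + xb * D0.
  by rewrite D0E D0'E /Delta /u; ring.
(* The weights $-2$ and $2c$ of the statement are what makes $(1-u)-2sq+(sq)^2$ equal to [Delta]. *)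
have FF : F1 * (1 - u) = F0 * Delta.
  have -> : F1 * (1 - u)
      = F0 * ((1 - u) + (s * q * (s * q) - 2 * (s * q)) * ((1 - u) * g)).
    by rewrite F1E; ring.
  by rewrite gE /Delta; ring.
(* [Delta] is $(1-sq)^2(1-k^2u)$ with $k$ inverse to $1-sq$; both factors are 1 minus a
   nilpotent. *)
have [h hE] : exists h, h * Delta = 1.
  have [k kE] : exists k, k * (1 - s * q) = 1.
    by apply: (@inv_one_sub _ _ m.+1); rewrite exprMn s0 mul0r.
  have [l lE] : exists l, l * (1 - k ^+ 2 * u) = 1.
    apply: (@inv_one_sub _ _ n.+1).
    by rewrite /u mulrCA exprMn t0 mul0r.
  exists (k ^+ 2 * l).
  have -> : k ^+ 2 * l * Delta
      = l * ((k * (1 - s * q)) ^+ 2 - k ^+ 2 * u) by rewrite /Delta; ring.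
  by rewrite kE expr1n lE.
have cancel P Q : P * (Delta * (1 - u)) = Q * (Delta * (1 - u)) -> P = Q.
  move=> /(congr1 (fun y => y * (h * g))).
  have e Y : Y * (Delta * (1 - u)) * (h * g) = Y * (h * Delta) * ((1 - u) * g).
    by ring.
  by rewrite !e hE gE !mulr1.
split; apply: cancel.
- have -> : D1 * F1 * (Delta * (1 - u)) = (D1 * Delta) * (F1 * (1 - u)) by ring.
  rewrite DD FF.
  have -> : ((1 - s * q) * D0 + t * xa * D0') * (F0 * Delta)
    = ((1 - s * q) * (D0 * F0) + t * xa * (D0' * F0)) * Delta by ring.
  by rewrite DA DA' E0E; ring.
- have -> : D1' * F1 * (Delta * (1 - u)) = (D1' * Delta) * (F1 * (1 - u)) by ring.
  rewrite DD' FF.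
  have -> : ((1 - s * q) * D0' + xb * D0) * (F0 * Delta)
    = ((1 - s * q) * (D0' * F0) + xb * (D0 * F0)) * Delta by ring.
  by rewrite DA DA' E0E; ring.
Qed.

(** * Induction on the number of variables *)

Definition ev_d (R : comNzRingType) (f : {rmorphism rat -> R}) (x : nat -> R)
    (N : nat) (h : H1) : R :=
  ev f x N (d h).

Lemma ev_d_is_zmod_morphism R f x N : zmod_morphism (@ev_d R f x N).
Proof. by move=> u v; rewrite /ev_d linearB raddfB. Qed.

HB.instance Definition _ (R : comNzRingType) (f : {rmorphism rat -> R})
    (x : nat -> R) (N : nat) :=
  GRing.isZmodMorphism.Build H1 R (@ev_d R f x N) (ev_d_is_zmod_morphism f x N).

Lemma ev_d1 R f x N : @ev_d R f x N 1 = 1.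
Proof.
have -> : (1 : H1) = zs [::] by rewrite /zs big_nil.
by rewrite /ev_d d_zs // d_basis_nil ev1.
Qed.

Lemma front_rec_ev R f x N :
  @front_rec R (x N) (ev f x N.+1) (ev f x N) (ev f x N).
Proof. exact: ev_cons. Qed.

Lemma front_rec_ev_d R f x N :
  @front_rec R (x N) (ev_d f x N.+1) (ev_d f x N) (ev_d f x N.+1).
Proof. exact: ev_d_cons. Qed.

(** Casts the absence of variables as a recursion step from zero maps, so that the lemmas of the
    induction step also compute the initial values. *)
Lemma front_rec0 (R : comNzRingType) (psi : {additive H1 -> R}) :
    (forall k h, (0 < k)%N -> psi (z k * h) = 0) ->
  front_rec 0 psi (\0 : {additive H1 -> R}) (\0 : {additive H1 -> R}).
Proof. by move=> psi0 k h k0; rewrite psi0 //= mulr0 addr0. Qed.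

Definition cyc_gen (R : comNzRingType) (s t : R) (m n a b c : nat)
    (psi : H1 -> R) : R :=
  gen2 s t m n (fun i j => psi (cyc a b c i j)).

Definition cyc'_gen (R : comNzRingType) (s t : R) (m n a b c : nat)
    (psi : H1 -> R) : R :=
  gen2 s t m n (fun i j => psi (cyc' a b c i j)).

(** Marking [p] by $-2s$ and [q] by $s^2$ yields the weight $(-2)^p$ and the degree $p+2q$ in
    $s$. *)
Definition pairs_gen (R : comNzRingType) (s t : R) (m n a b c : nat)
    (psi : H1 -> R) : R :=
  gen2 (- 2 * s) (s ^+ 2) m m (pairs t n (a + b) c (2 * c) psi).

Definition pow_gen (R : comNzRingType) (t : R) (n e : nat)
    (psi : H1 -> R) : R :=
  gen1 t n (fun k => psi (zs (nseq k e))).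

Lemma cyc_gen_rec (R : comNzRingType) (s t X : R)
    (psi' psi theta : {additive H1 -> R}) m n a b c :
    s ^+ m.+1 = 0 -> t ^+ n.+1 = 0 ->
    (0 < a)%N -> (0 < b)%N -> (0 < c)%N ->
    front_rec X psi' psi theta -> psi' 1 = psi 1 ->
  cyc_gen s t m n a b c psi' = cyc_gen s t m n a b c psi
    + s * X ^+ c * cyc_gen s t m n a b c theta
    + t * X ^+ a * cyc'_gen s t m n a b c theta.
Proof.
move=> s0 t0 a0 b0 c0 F e1; apply: gen2_rec => // i j.
by rewrite (cyc_rec _ _ a0 b0 c0 F) e1 subrr mul0rn addr0.
Qed.

Lemma cyc'_gen_rec (R : comNzRingType) (s t X : R)
    (psi' psi theta : {additive H1 -> R}) m n a b c :
    s ^+ m.+1 = 0 -> (0 < a)%N -> (0 < b)%N -> (0 < c)%N ->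
    front_rec X psi' psi theta ->
  cyc'_gen s t m n a b c psi' = cyc'_gen s t m n a b c psi
    + s * X ^+ c * cyc'_gen s t m n a b c theta
    + X ^+ b * cyc_gen s t m n a b c theta.
Proof.
move=> s0 a0 b0 c0 F; apply: gen2_rec0 => // i j.
exact: cyc'_rec.
Qed.

Lemma pairs_gen_rec (R : comNzRingType) (s t X : R)
    (psi' psi theta : {additive H1 -> R}) m n a b c :
    s ^+ m.+1 = 0 -> (0 < c)%N ->
    front_rec X psi' psi theta -> psi' 1 = psi 1 ->
  pairs_gen s t m n a b c psi' = pairs_gen s t m n a b c psi
    + - 2 * s * (X ^+ c * geo t X n (a + b)) * pairs_gen s t m n a b c theta
    + s ^+ 2 * ((X ^+ c) ^+ 2 * geo t X n (a + b))
        * pairs_gen s t m n a b c theta.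
Proof.
move=> s0 c0 F e1; apply: gen2_rec => [||p q].
- by rewrite exprMn s0 mulr0.
- by rewrite exprAC s0 expr0n.
rewrite (pairs_rec _ _ _ _ _ c0 _ F) ?muln_gt0 ?c0 // e1 subrr mul0rn addr0.
by rewrite -exprM [(c * 2)%N]mulnC.
Qed.

Lemma pow_gen_rec (R : comNzRingType) (t X : R)
    (psi' psi theta : {additive H1 -> R}) n e :
    t ^+ n.+1 = 0 -> (0 < e)%N ->
    front_rec X psi' psi theta -> psi' 1 = psi 1 ->
  pow_gen t n e psi' = pow_gen t n e psi + t * X ^+ e * pow_gen t n e theta.
Proof.
move=> t0 e0 F e1; rewrite /pow_gen.
have /eq_gen1-> : (fun k => psi' (zs (nseq k e))) =1 (fun k =>
    psi (zs (nseq k e)) + X ^+ e * shift (fun k' => theta (zs (nseq k' e))) k).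
  by case=> [|k] /=; rewrite ?zs_cons ?F // mulr0 addr0 /zs big_nil.
by rewrite gen1D gen1Z gen1_shift //; ring.
Qed.

(** Only the empty word survives without variables, and it never occurs in [cyc']. *)
Lemma gens0 (R : comNzRingType) (s t : R) (psi : {additive H1 -> R})
    m n a b c :
    (0 < a)%N -> (0 < b)%N -> (0 < c)%N ->
    (forall k h, (0 < k)%N -> psi (z k * h) = 0) -> psi 1 = 1 ->
  [/\ cyc_gen s t m n a b c psi = 1, cyc'_gen s t m n a b c psi = 0,
      pairs_gen s t m n a b c psi = 1 & pow_gen t n (a + b) psi = 1].
Proof.
move=> a0 b0 c0 /front_rec0 F psi1.
have cycE i j : psi (cyc a b c i j) = ((i == 0%N) && (j == 0%N))%:R.
  rewrite (cyc_rec _ _ a0 b0 c0 F) /= psi1 subr0.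
  by case: i j => [|i] [|j]; rewrite /= !mulr0 !add0r.
have cyc'E i j : psi (cyc' a b c i j) = 0.
  rewrite (cyc'_rec _ _ a0 b0 c0 F) /=.
  by case: i => [|i]; rewrite /= !mulr0 !add0r.
have c20 : (0 < 2 * c)%N by rewrite muln_gt0 c0.
have pairs0 p q : pairs t n (a + b) c (2 * c) \0 p q = 0.
  by rewrite /pairs big1 // => u _; rewrite big1 // => v _; rewrite mulr0.
have pairsE p q : pairs t n (a + b) c (2 * c) psi p q
    = ((p == 0%N) && (q == 0%N))%:R.
  rewrite (pairs_rec _ _ _ _ _ c0 c20 F) /= psi1 subr0 pairs0.
  by case: p q => [|p] [|q]; rewrite /= ?pairs0 !mulr0 !add0r.
split.
- by rewrite /cyc_gen gen2_delta => [|i j|j]; rewrite cycE.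
- by rewrite /cyc'_gen gen2_delta => [|i j|j]; rewrite cyc'E.
- by rewrite /pairs_gen gen2_delta => [|i j|j]; rewrite pairsE.
rewrite /pow_gen gen1_delta => [|k]; first by rewrite /zs big_nil.
by rewrite /= zs_cons F ?addn_gt0 ?a0 //= mulr0 addr0.
Qed.

(** The second identity is carried along because the matrix of one variable mixes [cyc] with
    [cyc']. *)
Lemma transfer (R : comNzRingType) (f : {rmorphism rat -> R}) (x : nat -> R)
    (s t : R) m n a b c N :
    s ^+ m.+1 = 0 -> t ^+ n.+1 = 0 ->
    (0 < a)%N -> (0 < b)%N -> (0 < c)%N ->
  cyc_gen s t m n a b c (ev_d f x N) * pairs_gen s t m n a b c (ev f x N)
    = cyc_gen (- s) t m n a b c (ev f x N) * pow_gen t n (a + b) (ev_d f x N)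
  /\
  cyc'_gen s t m n a b c (ev_d f x N) * pairs_gen s t m n a b c (ev f x N)
    = cyc'_gen (- s) t m n a b c (ev f x N) * pow_gen t n (a + b) (ev_d f x N).
Proof.
move=> s0 t0 a0 b0 c0; elim: N => [|N [IH IH']].
  have [|||||-> -> _ ->] := @gens0 R s t (ev_d f x 0) m n a b c => //.
  - by move=> k h k0; apply: ev0_d_cons.
  - exact: ev_d1.
  have [|||||-> -> _ _] := @gens0 R (- s) t (ev f x 0) m n a b c => //.
  - by move=> k h k0; apply: ev0_cons.
  - exact: ev1.
  have [|||||_ _ -> _] := @gens0 R s t (ev f x 0) m n a b c => //.
  - by move=> k h k0; apply: ev0_cons.
  - exact: ev1.
have Ns0 : (- s) ^+ m.+1 = 0 by rewrite exprNn s0 mulr0.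
have F := front_rec_ev f x N; have Fd := front_rec_ev_d f x N.
have e1 : ev f x N.+1 1 = ev f x N 1 by rewrite !ev1.
have e1d : ev_d f x N.+1 1 = ev_d f x N 1 by rewrite !ev_d1.
apply: (@transfer_step _ s t (x N ^+ c) (x N ^+ a) (x N ^+ b)
  (geo t (x N) n (a + b)) m n _ _ _ _ _ _ _ _ _ _ _ _ s0 t0 _ _ _ _ _ _ _ IH IH').
- by rewrite -exprD geoE.
- exact: cyc_gen_rec.
- exact: cyc'_gen_rec.
- exact: pairs_gen_rec.
- exact: cyc_gen_rec.
- exact: cyc'_gen_rec.
- by rewrite -exprD; apply: pow_gen_rec; rewrite // addn_gt0 a0.
Qed.

(** * Coefficient extraction and the sums of the statement *)

Lemma zs_nseq e k : zs (nseq k e) = z e ^+ k.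
Proof. by rewrite /zs big_nseq; elim: k => //= k ->; rewrite exprS. Qed.

Lemma cycE a b c i j : cyc a b c i j = sh (z c ^+ i) ((z a * z b) ^+ j).
Proof.
rewrite /cyc zs_nseq; congr sh; elim: j => [|j IH]; first by rewrite /zs big_nil.
by rewrite exprS -IH -mulrA -!zs_cons.
Qed.

Lemma zs_vals e c p K (u : {ffun 'I_p -> 'I_K}) :
  zs (lift_exps e c (vals u)) = \prod_(k < p) z (e * u k + c)%N.
Proof. by rewrite /zs /lift_exps /vals !big_map [index_enum _]unlock. Qed.

Lemma sumn_vals p K (u : {ffun 'I_p -> 'I_K}) :
  sumn (vals u) = (\sum_(k < p) u k)%N.
Proof. by rewrite sumnE /vals big_map big_enum. Qed.

Lemma pairsE (R : comNzRingType) (t : R) n e c c' (psi : H1 -> R) p q :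
  pairs t n e c c' psi p q =
    \sum_(u : {ffun 'I_p -> 'I_n.+1}) \sum_(v : {ffun 'I_q -> 'I_n.+1})
      t ^+ (\sum_(k < p) u k + \sum_(k < q) v k)
        * psi (sh (\prod_(k < p) z (e * u k + c)%N)
                  (\prod_(k < q) z (e * v k + c')%N)).
Proof.
have mb r s : (s \in boxes r n.+1) =
    [&& size s == r, all (ltn^~ n.+1) s & true].
  by rewrite mem_boxes andbT.
rewrite /pairs -(big_vals (P := xpredT) _ (boxes_uniq _ _) (mb p)).
apply: eq_bigr => u _.
rewrite -(big_vals (P := xpredT) _ (boxes_uniq _ _) (mb q)).
by apply: eq_bigr => v _; rewrite !sumn_vals !zs_vals.
Qed.

Lemma eq_gen2 (R : comNzRingType) (s t : R) m n f g :
  (forall i j, f i j = g i j) -> gen2 s t m n f = gen2 s t m n g.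
Proof. by move=> e; apply: eq_gen1 => i; apply: eq_gen1 => j. Qed.

Lemma eq_pairs (R : comNzRingType) (t : R) n e c c' (psi psi' : H1 -> R) p q :
  psi =1 psi' -> pairs t n e c c' psi p q = pairs t n e c c' psi' p q.
Proof.
by move=> E; apply: eq_bigr => u _; apply: eq_bigr => v _; rewrite E.
Qed.

Theorem theorem2p14 (a b c m n : nat)
    (ha : (1 <= a)%N) (hb : (1 <= b)%N) (hc : (1 <= c)%N) :
  \sum_(i < m.+1) \sum_(p < m.+1) \sum_(q < m.+1 | (i + p + 2 * q == m)%N)
    \sum_(j < n.+1) \sum_(u : {ffun 'I_p -> 'I_n.+1})
      \sum_(v : {ffun 'I_q -> 'I_n.+1}
             | (j + \sum_(k < p) u k + \sum_(k < q) v k == n)%N)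
        (- 2 : rat) ^+ p *:
          star (d (sh (z c ^+ i) ((z a * z b) ^+ j)))
               (sh (\prod_(k < p) z ((a + b) * u k + c)%N)
                   (\prod_(k < q) z ((a + b) * v k + 2 * c)%N))
  = (-1 : rat) ^+ m *:
      \sum_(j < n.+1) \sum_(k < n.+1 | (j + k == n)%N)
        star (sh (z c ^+ m) ((z a * z b) ^+ j)) (d (z (a + b)%N ^+ k)).
Proof.
apply/eqP; rewrite -subr_eq0; apply/eqP; apply: ev_inj => R f x N.
rewrite raddfB /= evZ; apply/eqP; rewrite subr_eq0; apply/eqP.
have [R' [C [s [t [cf [s0 t0 cfE]]]]]] := nilpotent_ext2 R m n.
pose Cf : {rmorphism rat -> R'} := C \o f.
(* Only the identity for [cyc] is needed; [cf] takes its coefficient of $s^m t^n$. *)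
have [/(congr1 cf) + _] := transfer Cf (C \o x) N s0 t0 ha hb hc.
have evC h : ev Cf (C \o x) N h = C (ev f x N h) by exact: ev_rmorph.
rewrite /cyc_gen /pairs_gen /pow_gen /ev_d => T.
transitivity (cf (gen2 s t m n (fun i j => C (ev f x N (d (cyc a b c i j))))
  * gen2 (- 2 * s) (s ^+ 2) m m
      (pairs t n (a + b) c (2 * c) (fun h => C (ev f x N h))))).
  rewrite [in RHS]/gen2 [gen1 s m _]/gen1 mulr_suml.
  rewrite [LHS]raddf_sum [RHS]raddf_sum.
  apply: eq_bigr => i _; rewrite [gen1 (- 2 * s) m _]/gen1 mulr_sumr.
  rewrite [LHS]raddf_sum [RHS]raddf_sum.
  apply: eq_bigr => p _; rewrite [gen1 (s ^+ 2) m _]/gen1.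
  rewrite [(- 2 * s) ^+ p * _]mulr_sumr [X in cf X]mulr_sumr.
  rewrite [LHS]raddf_sum [RHS]raddf_sum.
  rewrite [LHS]big_mkcond; apply: eq_bigr => q _ /=.
  (* The summation conditions become a 0-1 factor, the form in which [cfE] produces them. *)
  transitivity (\sum_(j < n.+1) \sum_(u : {ffun 'I_p -> 'I_n.+1})
     \sum_(v : {ffun 'I_q -> 'I_n.+1})
       ((i + p + 2 * q == m)%N
         && (j + \sum_(k < p) u k + \sum_(k < q) v k == n)%N)%:R
       * (f ((- 2) ^+ p) * (ev f x N (d (cyc a b c i j)) *
         ev f x N (sh (\prod_(k < p) z ((a + b) * u k + c)%N)
                   (\prod_(k < q) z ((a + b) * v k + 2 * c)%N))))).
    case: eqP => [_|_]; last first.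
      by rewrite big1 // => j _; rewrite big1 // => u _; rewrite big1 // => v _;
        rewrite mul0r.
    rewrite raddf_sum; apply: eq_bigr => j _.
    rewrite raddf_sum; apply: eq_bigr => u _.
    rewrite raddf_sum big_mkcond; apply: eq_bigr => v _.
    case: ifP => _ /=; rewrite ?mul0r ?mul1r //.
    by rewrite evZ ev_star cycE.
  rewrite pairsE /gen1 [s ^+ i * _]mulr_sumr mulr_suml [RHS]raddf_sum.
  apply: eq_bigr => j _; rewrite !mulr_sumr [RHS]raddf_sum.
  apply: eq_bigr => u _; rewrite !mulr_sumr [RHS]raddf_sum.
  apply: eq_bigr => v _.
  rewrite -cfE; congr (cf _).
  rewrite !rmorphM rmorphXn rmorphXn !rmorphN !rmorph_nat.
  by rewrite (exprD s) (exprD s i) exprM !(exprD t) (exprMn p); ring.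
transitivity (cf (gen2 (- s) t m n (fun i j => C (ev f x N (cyc a b c i j)))
  * gen1 t n (fun k => C (ev f x N (d (zs (nseq k (a + b)%N))))))).
  have <- := eq_gen2 _ _ _ _ (fun i j => evC (d (cyc a b c i j))).
  have <- := eq_gen2 _ _ _ _ (fun i j => evC (cyc a b c i j)).
  have <- := eq_gen1 _ _ (fun k => evC (d (zs (nseq k (a + b)%N)))).
  have <- := eq_gen2 _ _ _ _ (fun p q =>
    eq_pairs t n (a + b)%N c (2 * c)%N p q evC).
  exact: T.
(* Here [s] occurs only as $(-s)^i$, so only $i=m$ survives, with sign $(-1)^m$. *)
have row i : cf ((- s) ^+ i * gen1 t n (fun j => C (ev f x N (cyc a b c i j)))
      * gen1 t n (fun k => C (ev f x N (d (zs (nseq k (a + b)%N))))))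
  = \sum_(j < n.+1) \sum_(k < n.+1) ((i == m) && (j + k == n)%N)%:R
      * (f ((- 1) ^+ i) * (ev f x N (cyc a b c i j)
           * ev f x N (d (zs (nseq k (a + b)%N))))).
  rewrite -mulrA /gen1 big_distrlr mulr_sumr [LHS]raddf_sum.
  apply: eq_bigr => j _; rewrite mulr_sumr [LHS]raddf_sum.
  apply: eq_bigr => k _; rewrite -cfE; congr (cf _).
  rewrite !rmorphM !rmorphXn !rmorphN !rmorph1 [in LHS]exprNn (exprD t).
  by rewrite /=; ring.
rewrite /gen2 [gen1 (- s) m _]/gen1 mulr_suml [LHS]raddf_sum.
rewrite (bigD1 ord_max) //= [X in _ + X]big1 ?addr0 => [|i im]; last first.
  rewrite row (negPf (im : i != m :> nat)) big1 // => j _; rewrite big1 // => k _.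
  by rewrite mul0r.
rewrite row eqxx raddf_sum mulr_sumr; apply: eq_bigr => j _.
rewrite [X in _ = _ * X]raddf_sum mulr_sumr [RHS]big_mkcond.
apply: eq_bigr => k _ /=.
by case: ifP => _; rewrite ?mul0r // mul1r ev_star cycE zs_nseq.
Qed.
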